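(* The function $\frac{2\log n}{n}$ is a sharp threshold for the property that the temporal graph contains at least one temporal source. More specifically, let $\varepsilon(n)=\frac{3(\log n)^{0.8}}{n}$. There is $N$ such that for all $n\ge N$ and all $p\in[0,1]$, a random temporal graph $\mathcal G\sim\mathcal F_{n,p}$ (i) does not contain a temporal source with probability at least $1-2n^{-\sqrt{\log n}}$, if $p<\frac{2\log n}{n}-\varepsilon(n)$; (ii) contains a temporal source with probability at least $1-\frac{5}{\log n}$, if $p>\frac{2\log n}{n}+\varepsilon(n)$.
   Context: A simple temporal graph is a pair $(G,\lambda)$ where $G=(V,E)$ is a finite simple undirected graph and $\lambda:E\to\mathbb R$ assigns a single time label to each edge. A temporal $(u,v)$-path is a path $u=u_0,\dots,u_\ell=v$ in $G$ with $\lambda(u_0u_1)\le\dots\le\lambda(u_{\ell-1}u_\ell)$. A vertex $v$ is a temporal source if every other vertex can be reached from $v$ by a temporal path. For $n\in\mathbb N$ and $p\in[0,1]$, the model $\mathcal F_{n,p}$: draw $G$ from the Erdős–Rényi model $G_{n,p}$ on $n$ labelled vertices and give each edge of $G$ an independent time label uniform in $[0,1]$. $\log$ is the natural logarithm. A property holds a.a.s. if its probability tends to $1$ as $n\to\infty$. A function $p=p(n)$ is a sharp threshold for a property $\mathcal P$ if for every $\varepsilon>0$, a random temporal graph from $\mathcal F_{n,(1-\varepsilon)p}$ a.a.s. does not have $\mathcal P$, while one from $\mathcal F_{n,(1+\varepsilon)p}$ a.a.s. has $\mathcal P$. *)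

(* Defs.v *)
From HB Require Import structures.
From mathcomp Require Import all_boot all_order all_algebra.
From mathcomp Require Import all_classical all_reals all_analysis.

Set Implicit Arguments.
Unset Strict Implicit.
Unset Printing Implicit Defensive.

Import Order.TTheory GRing.Theory Num.Theory.
Import numFieldNormedType.Exports.

Local Open Scope classical_set_scope.
Local Open Scope ring_scope.

(* Only the values of [tg_label] on [tg_edges] are meaningful; nothing below
   looks at the others. *)
Record tgraph (R : realType) (V : finType) := TGraph {
  tg_edges : {set {set V}};
  tg_label : {set V} -> R;
  tg_simple : forall e, e \in tg_edges -> #|e| = 2%N }.

Section temporal_paths.
Context (R : realType) (V : finType).
Implicit Types (G : tgraph R V) (u v w : V) (s : seq V).

Definition tg_adj G : rel V := fun u v => [set u; v]%SET \in tg_edges G.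

Definition tg_time G u v : R := tg_label G [set u; v]%SET.

(* [u :: s] is the vertex sequence of the path. *)
Definition temporal_path G u v s : bool :=
  [&& path (tg_adj G) u s, last u s == v, uniq (u :: s) &
      sorted <=%R (pairmap (tg_time G) u s)].

Definition temporal_source G v : Prop :=
  forall w, w != v -> exists s, temporal_path G v w s.

Definition has_temporal_source G : Prop := exists v, temporal_source G v.

End temporal_paths.

Section tuple_probability.
Context d (T : measurableType d) (R : realType).

Definition tcons n (x : T * n.-tuple T) : n.+1.-tuple T :=
  [tuple of x.1 :: x.2].

Lemma measurable_tcons n : measurable_fun [set: T * n.-tuple T] (@tcons n).
Proof. exact: measurable_cons. Qed.

HB.instance Definition _ n :=
  isMeasurableFun.Build _ _ _ _ (@tcons n) (@measurable_tcons n).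

(* The law of n independent draws from P. *)
Fixpoint tuple_prob (P : probability T R) (n : nat) : probability (n.-tuple T) R :=
  match n with
  | 0 => \d_([tuple] : 0.-tuple T)
  | m.+1 => distribution (P \x tuple_prob P m)%E (@tcons m)
  end.

Lemma tuple_prob_rect (P : probability T R) n (A : 'I_n -> set T) :
  (forall i, measurable (A i)) ->
  tuple_prob P n [set t | forall i, A i (tnth t i)] = (\prod_(i < n) P (A i))%E.
Proof.
elim: n A => [|n IH] A mA /=.
  rewrite big_ord0 diracE mem_set//= => -[]//.
rewrite big_ord_recl /= /distribution /pushforward.
rewrite -(IH (fun i => A (lift ord0 i)))//; set B := [set t | _] in IH *.
have mB : measurable [set t : n.-tuple T | forall i, A (lift ord0 i) (tnth t i)].
  rewrite (_ : [set t | _] =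
    \bigcap_(i in [set: 'I_n]) ((@tnth n T ^~ i) @^-1` A (lift ord0 i))).
    apply: fin_bigcap_measurable => [|i _]; first exact: finite_finset.
    by rewrite -[X in measurable X]setTI; apply: measurable_tnth.
  by apply/seteqP; split => t /= h i; [move=> _|]; apply: h.
rewrite -product_measure1E//; congr (_ _).
apply/seteqP; split=> -[x t] /=.
  move=> h; split => [|i]; first exact: (h ord0).
  by have := h (lift ord0 i); rewrite tnthS.
move=> [h0 hS] i; case: (unliftP ord0 i) => [j ->|->]//.
by rewrite tnthS; apply: hS.
Qed.

End tuple_probability.

Section random_model.
Context (R : realType) (n : nat).

Definition vpair := {e : {set 'I_n} | #|e| == 2%N}.

(* One (presence, label) pair for every possible edge; the label of an absent
   edge is drawn but discarded. *)
Definition sample := #|{: vpair}|.-tuple (bool * measurableTypeR R).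

Definition sample_edges (w : sample) : {set {set 'I_n}} :=
  [set val e | e : vpair & (tnth w (enum_rank e)).1]%SET.

Definition sample_label (w : sample) (s : {set 'I_n}) : R :=
  if insub s is Some e then (tnth w (enum_rank (e : vpair))).2 else 0.

Lemma sample_simple w e : e \in sample_edges w -> #|e| = 2%N.
Proof. by case/imsetP => s _ ->; apply/eqP/(valP s). Qed.

Definition sample_tgraph (w : sample) : tgraph R 'I_n :=
  TGraph (sample_label w) (@sample_simple w).

(* For p outside [0, 1] [bernoulli_prob p] is the Dirac mass at [false]. *)
Definition Fmodel (p : R) : probability sample R :=
  tuple_prob (bernoulli_prob p \x uniform_prob (@ltr01 R))%E #|{: vpair}|.

Definition Fprob (p : R) (Q : tgraph R 'I_n -> Prop) : \bar R :=
  Fmodel p [set w | Q (sample_tgraph w)].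

End random_model.

Lemma measurable_has_temporal_source (R : realType) (n : nat) :
  measurable [set w : sample R n | has_temporal_source (sample_tgraph w)].
Proof.
have madj u v : measurable_fun [set: sample R n]
    (fun w => tg_adj (sample_tgraph w) u v).
  rewrite /tg_adj /=; case: (insubP (vpair n) [set u; v]%SET) => [e _ ee|ne].
  - rewrite (_ : (fun w => [set u; v]%SET \in sample_edges w) =
      fun w : sample R n => (tnth w (enum_rank e)).1).
      by apply: (measurableT_comp measurable_fst); exact: measurable_tnth.
    apply/funext => w; apply/imsetP/idP => [[e' we' h]|we].
      by rewrite (_ : e = e') ?inE// in we' *; apply: val_inj; rewrite ee h.
    by exists e; rewrite ?inE// -ee.
  - rewrite (_ : (fun w : sample R n => [set u; v]%SET \in sample_edges w) = fun=> false); first exact: measurable_cst.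
    apply/funext => w; apply/negbTE/negP => /sample_simple /eqP h.
    by rewrite h in ne.
have mtime u v : measurable_fun [set: sample R n]
    (fun w => tg_time (sample_tgraph w) u v).
  rewrite /tg_time /= /sample_label; case: insubP => [e _ _|_].
    by apply: (measurableT_comp measurable_snd); exact: measurable_tnth.
  exact: measurable_cst.
have mtp u v s : measurable_fun [set: sample R n]
    (fun w => temporal_path (sample_tgraph w) u v s).
  rewrite /temporal_path; apply: measurable_and => /=.
    elim: s u {v} => [|x s IH] u /=; first exact: measurable_cst.
    exact: measurable_and.
  apply: measurable_and; first exact: measurable_cst.
  apply: measurable_and; first exact: measurable_cst.
  case: s => [|x s] /=; first exact: measurable_cst.
  elim: s u {v} x => [|y s IH] u x /=; first exact: measurable_cst.
  apply: measurable_and; last exact: IH.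
  apply: measurable_realfun.measurable_fun_ler; exact: mtime.
rewrite (_ : [set w | _] = \bigcup_(v in [set: 'I_n])
    \bigcap_(x in [set x : 'I_n | x != v])
    \bigcup_(s in [set: seq 'I_n])
      [set w | temporal_path (sample_tgraph w) v x s]).
  apply: fin_bigcup_measurable => [|v _]; first exact: finite_finset.
  apply: fin_bigcap_measurable => [|x _]; first exact: finite_finset.
  apply: countable_bigcupT_measurable => [|s].
    exact: countableP.
  by rewrite -[X in measurable X]setTI; apply: (mtp v x s) => //.
apply/seteqP; split => w /=.
  by move=> [v h]; exists v => // x /h [s ?]; exists s.
by move=> [v _ h]; exists v => x /h [s _ ?]; exists s.
Qed.

Section thresholds.
Context (R : realType).
Implicit Types (Q : forall n : nat, tgraph R 'I_n -> Prop) (p : nat -> R).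

Definition aas p Q : Prop :=
  (fun n => Fprob (p n) (@Q n)) @ \oo --> (1%:E : \bar R).

(* The perturbed probabilities (1 - e) p and (1 + e) p may leave [0, 1]. *)
Definition clip01 (x : R) : R := Num.max 0 (Num.min 1 x).

Definition sharp_threshold p Q : Prop :=
  forall e : R, 0 < e ->
    aas (fun n => clip01 ((1 - e) * p n)) (fun n G => ~ @Q n G) /\
    aas (fun n => clip01 ((1 + e) * p n)) Q.

End thresholds.

(* Main.v *)
Require Import Defs.
From mathcomp Require Import all_boot all_order all_algebra.
From mathcomp Require Import all_classical all_reals all_analysis.
From mathcomp Require Import ring lra zify.

(** Cut time into [m] slots, so that a sample becomes a function from edges to
    slots (or [None] for an absent edge) with independent values, and explore
    from a vertex [v]: in each slot, the edges of that slot which leave the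
    reached set enlarge it.  Whatever the exploration has revealed, an edge
    leaving the reached set carries the next slot with conditional probability
    between [p / m] and [p / ((1 - p) m)].  Hence the size [k] of the reached set
    grows like a pure birth process with rates about [k (n - k) p], whose time
    to reach [n] concentrates around [2 ln n / (n p)].  Both tails follow by the
    exponential moment method, applied to a function of [k] whose expectation is
    multiplied by at most [1 + s / m] (respectively [1 - s / m]) in each slot, up
    to an error [O(1 / m ^ 2)] caused by two edges sharing a slot; the errors
    vanish as [m] tends to infinity. *)

Set Implicit Arguments.
Unset Strict Implicit.
Unset Printing Implicit Defensive.

Import Order.TTheory GRing.Theory Num.Theory.
Import numFieldNormedType.Exports.

Local Open Scope ring_scope.

(** * Finite product laws *)

Section finite_product_law.
Context (R : realType) (I X : finType) (q : X -> R).
Context (q_ge0 : forall x, 0 <= q x) (q_sum1 : \sum_x q x = 1).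
Implicit Types (d : {ffun I -> X}) (f h : {ffun I -> X} -> R).

Definition weight d : R := \prod_i q (d i).

Definition Ex f : R := \sum_d weight d * f d.

Definition resample d i x : {ffun I -> X} :=
  [ffun j => if j == i then x else d j].

Lemma resample_same d i x : resample d i x i = x.
Proof. by rewrite ffunE eqxx. Qed.

Lemma resample_id d i : resample d i (d i) = d.
Proof. by apply/ffunP => j; rewrite ffunE; case: eqP => // ->. Qed.

Lemma resample_resample d i x y : resample (resample d i x) i y = resample d i y.
Proof. by apply/ffunP => j; rewrite !ffunE; case: eqP. Qed.

Lemma weight_ge0 d : 0 <= weight d.
Proof. exact: prodr_ge0. Qed.

Lemma eq_Ex f h : f =1 h -> Ex f = Ex h.
Proof. by move=> fh; apply: eq_bigr => d _; rewrite fh. Qed.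

Lemma ler_Ex f h : (forall d, f d <= h d) -> Ex f <= Ex h.
Proof. by move=> fh; apply: ler_sum => d _; rewrite ler_wpM2l ?weight_ge0. Qed.

Lemma ExD f h : Ex (fun d => f d + h d) = Ex f + Ex h.
Proof. by rewrite -big_split; apply: eq_bigr => d _; rewrite mulrDr. Qed.

Lemma ExZ a f : Ex (fun d => a * f d) = a * Ex f.
Proof. by rewrite mulr_sumr; apply: eq_bigr => d _; rewrite mulrCA. Qed.

Lemma Ex_sum (J : finType) (P : pred J) (F : J -> {ffun I -> X} -> R) :
  Ex (fun d => \sum_(j | P j) F j d) = \sum_(j | P j) Ex (F j).
Proof. by rewrite exchange_big; apply: eq_bigr => d _; rewrite mulr_sumr. Qed.

Lemma Ex1 : Ex (fun=> 1) = 1.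
Proof.
rewrite /Ex /weight; under eq_bigr do rewrite mulr1.
by rewrite -(bigA_distr_bigA (fun _ x => q x)) big1.
Qed.

Lemma Ex_cst a : Ex (fun=> a) = a.
Proof. by rewrite -[a in LHS]mulr1 ExZ Ex1 mulr1. Qed.

Lemma weight_resample d i x :
  q (d i) * weight (resample d i x) = q x * weight d.
Proof.
rewrite /weight (bigD1 i)//= [in RHS](bigD1 i)//= resample_same mulrCA.
congr (_ * (_ * _)); apply: eq_bigr => j ji; by rewrite ffunE (negbTE ji).
Qed.

(** This plays the role of conditioning on [d i = x], with no division by [q x]. The configurations
    sharing one value of [resample d i x] form a fibre indexed by the value at [i], and their
    weights add up because [q] sums to 1. *)
Lemma Ex_resample h i x :
  q x * Ex (fun d => h (resample d i x)) = Ex (fun d => (d i == x)%:R * h d).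
Proof.
rewrite /Ex (partition_big (fun d => resample d i x) (fun d => d i == x)) /=;
  last by move=> d _; rewrite resample_same.
rewrite [RHS](bigID (fun d => d i == x)) /= [X in _ + X]big1 ?addr0; last first.
  by move=> d /negbTE ->; rewrite mul0r mulr0.
rewrite mulr_sumr; apply: eq_bigr => d /eqP dix; rewrite dix eqxx mul1r.
transitivity (q x * \sum_y weight (resample d i y) * h d).
  congr (_ * _).
  rewrite (reindex_onto (resample d i) (fun d' => d' i)) /=; last first.
    move=> d' /eqP <-; rewrite resample_resample; exact: resample_id.
  apply: eq_big => [y|y _].
    by rewrite resample_same resample_resample -dix resample_id !eqxx.
  by rewrite resample_resample -dix resample_id.
rewrite -mulr_suml mulrA; congr (_ * _).
rewrite mulr_sumr -dix.
under eq_bigr do rewrite weight_resample.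
by rewrite -mulr_suml q_sum1 mul1r.
Qed.

Lemma Ex_coord i x : Ex (fun d => (d i == x)%:R) = q x.
Proof.
have := Ex_resample (fun=> 1) i x; rewrite Ex1 mulr1 => ->.
by apply: eq_Ex => d; rewrite mulr1.
Qed.

Lemma Ex_coord2 i j x y : i != j ->
  Ex (fun d => (d i == x)%:R * (d j == y)%:R) = q x * q y.
Proof.
move=> ij; rewrite -(Ex_resample (fun d => (d j == y)%:R)) -(Ex_coord j y).
by congr (_ * _); apply: eq_Ex => d; rewrite ffunE (eq_sym j) (negbTE ij).
Qed.

End finite_product_law.

(** * Exploration in discrete time *)

Section spreading.
Context (n m : nat).
Local Notation E := (vpair n).
Implicit Types (d : {ffun E -> option 'I_m}) (e : E) (S : {set 'I_n}) (v w : 'I_n).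

Definition fires d j e : bool := if d e is Some i then i == j :> nat else false.

Definition crosses S e : bool := #|val e :&: S| == 1%N.

(** Stage [j] accounts for the slots below [j]. All edges of a slot are tested against the set as it
    stood when the slot began, so two consecutive edges of one slot are not followed. *)
Fixpoint reached d v j : {set 'I_n} :=
  if j is i.+1 then
    reached d v i :|: \bigcup_(e | fires d i e && crosses (reached d v i) e) val e
  else [set v]%SET.

(** Outside this event at most one edge fires in slot [j]. Summed over all slots, its probability is
    [O(1/m)]. *)
Definition collides d j : bool :=
  [exists e, exists e', [&& e != e', fires d j e & fires d j e']].

Lemma crossesP S e : reflect
  (exists u w, [/\ u \in S, w \notin S & val e = [set u; w]%SET]) (crosses S e).
Proof.
apply: (iffP idP).
  case/cards1P => u eSu.
  have : u \in val e :&: S by rewrite eSu set11.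
  rewrite inE => /andP[ue uS].
  have /cards2P[a [b [ab eab]]] := valP e.
  have mem x : (x \in [set a; b] :&: S)%SET = (x == u) by rewrite -eab eSu inE.
  have := mem a; have := mem b; rewrite !inE !eqxx orbT /=.
  have := ue; rewrite eab !inE => /orP[] /eqP uE; subst u.
    by rewrite eq_sym (negbTE ab) => bS aS; exists a, b; rewrite uS bS.
  by rewrite (negbTE ab) => bS aS; exists b, a; rewrite uS aS finset.setUC.
move=> [u [w [uS wS eE]]]; apply/cards1P; exists u; rewrite eE.
apply/finset.setP => x; rewrite !inE; case: eqP => [->|_] //=; case: eqP => [->|] //=.
by rewrite (negbTE wS).
Qed.

Lemma card_crosses S : #|[set e | crosses S e]%SET| = (#|S| * (n - #|S|))%N.
Proof.
have -> : (n - #|S|)%N = #|~: S|.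
  by have := cardsC S; rewrite card_ord => nE; rewrite -[X in (X - _)%N]nE addKn.
rewrite -cardsX.
pose f (x : 'I_n * 'I_n) := [set x.1; x.2]%SET.
have finj : {in finset.setX S (~: S) &, injective f}.
  move=> [a b] [a' b']; rewrite !inE /= => /andP[aS bS] /andP[a'S b'S].
  rewrite /f /= => fE.
  have : a \in [set a'; b']%SET by rewrite -fE !inE eqxx.
  have : b \in [set a'; b']%SET by rewrite -fE !inE eqxx orbT.
  rewrite !inE => /orP[/eqP bE|/eqP ->]; first by rewrite bE a'S in bS.
  by move=> /orP[/eqP ->//|/eqP aE]; rewrite aE (negbTE b'S) in aS.
rewrite -(card_in_imset finj) -(card_imset _ val_inj).
congr #|pred_of_set _|; apply/finset.setP => s; apply/imsetP/imsetP.
  move=> [e]; rewrite inE => /crossesP[u [w [uS wS eE]]] ->.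
  by exists (u, w) => //; rewrite !inE uS.
move=> [[u w]]; rewrite !inE /= => /andP[uS wS] ->.
have uw : u != w by apply: contraNneq wS => <-.
have e2 : #|[set u; w]%SET| == 2%N by rewrite cards2 uw.
exists (Sub [set u; w]%SET e2); last by rewrite SubK.
by rewrite inE; apply/crossesP; exists u, w; rewrite SubK.
Qed.

Lemma reachedS d v j : reached d v j \subset reached d v j.+1.
Proof. exact: finset.subsetUl. Qed.

Lemma reached_mono d v i j : (i <= j)%N -> reached d v i \subset reached d v j.
Proof.
move=> /subnK <-; elim: (j - i)%N => [//|k IH].
by apply: fintype.subset_trans IH _; rewrite addSn reachedS.
Qed.

Lemma card_reached_gt0 d v j : (0 < #|reached d v j|)%N.
Proof.
apply/card_gt0P; exists v; apply: (fintype.subsetP (reached_mono d v (leq0n j))).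
by rewrite inE.
Qed.

Lemma card_reached_le d v j : (#|reached d v j| <= n)%N.
Proof. by rewrite -[X in (_ <= X)%N]card_ord max_card. Qed.

(* An edge that crosses the set reached at slot [j] was of no use before slot
   [j], so the exploration up to [j] does not see its label. *)
Lemma reached_resample d v j e (x : option 'I_m) :
  crosses (reached d v j) e -> (forall i, x = Some i -> (j <= i)%N) ->
  reached (resample d e x) v j = reached d v j.
Proof.
move=> cr xj.
suff H k : (k <= j)%N -> reached (resample d e x) v k = reached d v k by exact: H.
elim: k => [//|k IH kj] /=; rewrite IH; last exact: ltnW.
congr (_ :|: _); apply: eq_bigl => e'; rewrite /fires ffunE.
case: (eqVneq e' e) => // ->.
have -> : (if x is Some i then i == k :> nat else false) = false.
  case: x xj {IH} => [i|//] /(_ i erefl) ji; apply/negbTE; move: ji kj; lia.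
(* Had [e] fired in slot [k] while crossing, both its ends would be reached by stage [j], and [e]
   would not cross there. *)
symmetry; apply/negbTE/negP => /= fc; move: cr; rewrite /crosses.
have /finset.setIidPl -> : val e \subset reached d v j.
  apply: fintype.subset_trans (reached_mono d v kj) => /=.
  by apply: fintype.subset_trans (finset.subsetUr _ _); apply: (finset.bigcup_sup e).
by have /eqP -> := valP e.
Qed.

(** At most one edge fires, and a crossing edge brings exactly one new vertex; so the growth equals
    the number of crossing edges that fire. *)
Lemma card_reached_step d v j : ~~ collides d j ->
  exists t : bool, #|reached d v j.+1| = (#|reached d v j| + t)%N /\
    (\sum_(e | crosses (reached d v j) e) fires d j e)%N = t.
Proof.
move=> nc; set S := reached d v j.
have uniqf e e' : fires d j e -> fires d j e' -> e' = e.
  move=> fe fe'; apply/eqP; apply: contraNT nc => ee'.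
  by apply/existsP; exists e'; apply/existsP; exists e; rewrite ee' fe fe'.
case: (pickP [pred e | fires d j e && crosses S e]) => [e /andP[fe ce]|none].
  exists true; split; last first.
    rewrite (bigD1 e)//= fe big1 => [//|e' /andP[_ ne]].
    by apply/eqP; rewrite eqb0; apply: contraNN ne => /(uniqf e) ->.
  rewrite /= -/S (big_pred1 e) => [|e' /=]; last first.
    apply/andP/eqP => [[/(uniqf e)->]//|->]; by rewrite fe ce.
  move: ce => /crossesP[u [w [uS wS ->]]].
  have -> : S :|: [set u; w]%SET = (w |: S)%SET.
    apply/finset.setP => x; rewrite !inE.
    by case: (eqVneq x u) => [->|_]; rewrite ?uS ?orbT//= orbC.
  by rewrite cardsU1 wS addnC.
exists false; split; last first.
  by rewrite big1 // => e ce; have /= := none e; rewrite ce andbT => ->.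
by rewrite /= -/S big_pred0 ?finset.setU0 ?addn0.
Qed.

End spreading.

(** * Drift of a potential *)

Section drift.
Context (R : realType) (n m : nat) (p : R).
Context (p01 : 0 <= p <= 1) (m_gt0 : (0 < m)%N).
Local Notation E := (vpair n).
Implicit Types (d : {ffun E -> option 'I_m}) (e : E) (v : 'I_n) (j : 'I_m).

Definition slot_law (x : option 'I_m) : R := if x is Some _ then p / m%:R else 1 - p.

Local Notation Exp := (Ex slot_law).

Lemma slot_law_ge0 x : 0 <= slot_law x.
Proof.
by case/andP: p01 => p0 p1; case: x => [j|] /=; rewrite ?subr_ge0 ?divr_ge0.
Qed.

Lemma slot_law_sum1 : \sum_x slot_law x = 1.
Proof.
rewrite (bigD1 None)//= (reindex_omap (@Some _) id) /=; last by case.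
rewrite (eq_bigl xpredT); last by move=> j; rewrite /= eqxx.
rewrite sumr_const card_ord -[X in _ + X]mulr_natr.
by rewrite mulfVK ?subrK// pnatr_eq0 -lt0n.
Qed.


Lemma firesE d j e : fires d j e = (d e == Some j).
Proof. by rewrite /fires; case: (d e). Qed.

Let slot_law_le (j : 'I_m) : slot_law (Some j) <= m%:R^-1.
Proof. by case/andP: p01 => p0 p1; rewrite /= ler_piMl. Qed.

(** Union bound over ordered pairs of distinct edges; by independence each pair contributes at most
    [1/m^2]. *)
Lemma Ex_collides j :
  Exp (fun d => (collides d j)%:R) <= #|{: E}|%:R ^+ 2 / m%:R ^+ 2.
Proof.
apply: (@le_trans _ _ (Exp (fun d =>
    \sum_e \sum_(e' | e != e') (d e == Some j)%:R * (d e' == Some j)%:R))).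
  apply: (ler_Ex slot_law_ge0) => d; case: (boolP (collides d j)) => [|_]; last first.
    by apply: sumr_ge0 => e _; apply: sumr_ge0 => e' _; rewrite mulr_ge0.
  case/existsP => e /existsP[e' /and3P[ee' fe fe']].
  rewrite (bigD1 e)//= (bigD1 e')//= -!firesE fe fe' mul1r -addrA lerDl.
  by apply: addr_ge0; do ?[apply: sumr_ge0 => *]; rewrite ?mulr_ge0.
rewrite Ex_sum; under eq_bigr => e _ do rewrite Ex_sum.
apply: (@le_trans _ _ (\sum_(e : E) \sum_(e' : E) m%:R^-1 ^+ 2)); last first.
  by rewrite !sumr_const /= -mulrnA -[leLHS]mulr_natl natrM -expr2 exprVn.
apply: ler_sum => e _; rewrite [leRHS](bigID (fun e' => e != e'))/=.
rewrite -[leLHS]addr0; apply: lerD; last by apply: sumr_ge0 => *; rewrite exprn_ge0.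
apply: ler_sum => e' ee'; rewrite (Ex_coord2 slot_law_sum1)// expr2.
by apply: ler_pM => //; exact: slot_law_ge0.
Qed.

(** * Conditional firing rate of a crossing edge *)

Section firing.
Context (v : 'I_n) (j : 'I_m) (e : E) (F : nat -> R).
Context (F_ge0 : forall k, 0 <= F k).

Let h d := (crosses (reached d v j) e)%:R * F #|reached d v j|.

Let h_ge0 d : 0 <= h d. Proof. by rewrite mulr_ge0. Qed.

Let h_resample d (x : option 'I_m) : (forall i, x = Some i -> (j <= i)%N) ->
  h d <= h (resample d e x).
Proof.
move=> xj; rewrite {1}/h; case: (boolP (crosses _ _)) => [cr|_]; last first.
  by rewrite mul0r.
by rewrite /h reached_resample// cr.
Qed.

Let ExfE : Exp (fun d => (fires d j e)%:R * h d) =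
  p / m%:R * Exp (fun d => h (resample d e (Some j))).
Proof.
rewrite (Ex_resample slot_law_sum1 h e (Some j)).
by apply: eq_Ex => d; rewrite firesE.
Qed.

(** Moving [e] into slot [j] leaves the reached set unchanged whenever [e] crosses it, hence cannot
    decrease [h]; the value [Some j] has probability [p / m]. *)
Lemma Ex_fires_ge : p / m%:R * Exp h <= Exp (fun d => (fires d j e)%:R * h d).
Proof.
rewrite ExfE ler_wpM2l//; first exact: (slot_law_ge0 (Some j)).
by apply: (ler_Ex slot_law_ge0) => d; apply: h_resample => i [<-].
Qed.

(** Compare with the configuration where [e] is absent: if [e] crosses, the reached set is the same.
    Absence has probability [1 - p], whence the factor [1 / (1 - p)]. *)
Lemma Ex_fires_le : p < 1 ->
  Exp (fun d => (fires d j e)%:R * h d) <= p / (1 - p) / m%:R * Exp h.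
Proof.
move=> p1; rewrite ExfE.
have -> : p / (1 - p) / m%:R * Exp h = p / m%:R * ((1 - p)^-1 * Exp h) by ring.
rewrite ler_wpM2l//; first exact: (slot_law_ge0 (Some j)).
rewrite ler_pdivlMl ?subr_gt0//.
apply: (@le_trans _ _ ((1 - p) * Exp (fun d => h (resample d e None)))).
  apply: ler_wpM2l; first by rewrite subr_ge0 ltW.
  apply: (ler_Ex slot_law_ge0) => d.
  have /= := @h_resample (resample d e (Some j)) None.
  by rewrite resample_resample; apply.
rewrite (Ex_resample slot_law_sum1 h e None); apply: (ler_Ex slot_law_ge0) => d.
by case: eqP => _; rewrite ?mul1r// mul0r.
Qed.

End firing.

(** * Growth or decay of the expected potential, slot by slot *)

Section potential.
Context (v : 'I_n) (g : nat -> R) (G r sigma : R).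
Context (g_bound : forall k, 0 <= g k <= G) (sigma_ge : - 1 <= sigma).
Let D k := g k.+1 - g k.
Context (fires_drift : forall j e,
  Exp (fun d => (fires d j e)%:R *
     ((crosses (reached d v j) e)%:R * D #|reached d v j|)) <=
  r / m%:R * Exp (fun d => (crosses (reached d v j) e)%:R * D #|reached d v j|)).
Context (g_drift : forall k, (0 < k <= n)%N ->
  r / m%:R * ((k * (n - k))%:R * D k) <= sigma * g k).

Let C := (1 + #|{: E}|%:R) * G.

Let G_ge0 : 0 <= G. Proof. by have /andP[] := g_bound 0; exact: le_trans. Qed.

Let D_bound k : `|D k| <= G.
Proof. by rewrite ler_norml /D; have := g_bound k; have := g_bound k.+1; lra. Qed.

(** Without a collision this is an equality. With one, the jump of [g] and the sum over edges are
    both controlled by [G], and [C] absorbs them. *)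
Let step_bound d j : g #|reached d v j.+1| <= g #|reached d v j| +
  \sum_e (fires d j e)%:R * ((crosses (reached d v j) e)%:R * D #|reached d v j|)
  + C * (collides d j)%:R.
Proof.
set k := #|reached d v j|.
case: (boolP (collides d j)) => cl.
  have sumD : `|\sum_e (fires d j e)%:R * ((crosses (reached d v j) e)%:R * D k)|
      <= #|{: E}|%:R * G.
    rewrite (_ : #|{: E}|%:R * G = \sum_(e : E) G); last first.
      by rewrite sumr_const mulr_natl.
    apply: (le_trans (ler_norm_sum _ _ _)); apply: ler_sum => e _.
    by case: (fires d j e); case: (crosses _ e); rewrite ?mul0r ?mul1r ?normr0.
  have := g_bound k; have := g_bound #|reached d v j.+1|.
  move: sumD; rewrite ler_norml mulr1 /C mulrDl mul1r; lra.
have [t [kS tE]] := card_reached_step v cl.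
rewrite mulr0 addr0 kS -/k.
have -> : \sum_e (fires d j e)%:R * ((crosses (reached d v j) e)%:R * D k) =
    t%:R * D k.
  rewrite -[in RHS]tE natr_sum mulr_suml [in RHS]big_mkcond.
  by apply: eq_bigr => e _; case: (crosses _ e); rewrite ?mul1r ?mul0r ?mulr0.
by case: t {kS tE} => /=; rewrite ?mul1r ?mul0r ?addn1 ?addn0 ?addr0 /D; lra.
Qed.

(** A reached set of size [k] is crossed by [k (n - k)] edges, each contributing at rate [r / m];
    [g_drift] turns the total into [sigma * g k]. *)
Lemma Ex_potential_step j : Exp (fun d => g #|reached d v j.+1|) <=
  (1 + sigma) * Exp (fun d => g #|reached d v j|) + C * (#|{: E}|%:R ^+ 2 / m%:R ^+ 2).
Proof.
have C_ge0 : 0 <= C by rewrite mulr_ge0// addr_ge0.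
apply: (le_trans (ler_Ex slot_law_ge0 (step_bound^~ j))).
rewrite !ExD ExZ; apply: lerD; last by rewrite ler_wpM2l// Ex_collides.
rewrite mulrDl mul1r lerD2l Ex_sum.
apply: (le_trans (ler_sum _ (fun e _ => fires_drift j e))).
rewrite -mulr_sumr -Ex_sum -!ExZ; apply: (ler_Ex slot_law_ge0) => d.
set S := reached d v j.
have -> : \sum_e (crosses S e)%:R * D #|S| = (#|S| * (n - #|S|))%:R * D #|S|.
  rewrite -mulr_suml -natr_sum -card_crosses; congr (_%:R * _).
  rewrite -sum1_card [RHS]big_mkcond /=.
  by apply: eq_bigr => e _; rewrite inE; case: crosses.
by apply: g_drift; rewrite card_reached_gt0 card_reached_le.
Qed.

(** Iteration from size 1 accumulates at most [m * M] copies of the one-slot error, which is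
    [O(1/m^2)]; the total error is [O(1/m)]. *)
Lemma Ex_potential M : (forall i, (i <= m)%N -> (1 + sigma) ^+ i <= M) ->
  Exp (fun d => g #|reached d v m|) <=
  (1 + sigma) ^+ m * g 1%N + M * C * #|{: E}|%:R ^+ 2 / m%:R.
Proof.
move=> leM.
have C_ge0 : 0 <= C by rewrite mulr_ge0// addr_ge0.
have rho_ge0 : 0 <= 1 + sigma by rewrite -lerBlDl sub0r.
set eps := C * (#|{: E}|%:R ^+ 2 / m%:R ^+ 2).
have eps_ge0 : 0 <= eps by rewrite mulr_ge0// divr_ge0// exprn_ge0.
have H i : (i <= m)%N -> Exp (fun d => g #|reached d v i|) <=
    (1 + sigma) ^+ i * g 1%N + (\sum_(k < i) (1 + sigma) ^+ k) * eps.
  elim: i => [_|i IH im].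
    rewrite big_ord0 expr0 mul1r mul0r addr0 -[leRHS](Ex_cst E slot_law_sum1).
    by apply: (ler_Ex slot_law_ge0) => d; rewrite cards1.
  apply: (le_trans (Ex_potential_step (Ordinal im))) => /=.
  rewrite -/eps big_ord_recl expr0 exprS.
  have -> : \sum_(k < i) (1 + sigma) ^+ bump 0 k =
      (1 + sigma) * \sum_(k < i) (1 + sigma) ^+ k.
    by rewrite mulr_sumr; apply: eq_bigr => k _; rewrite exprS.
  have := ler_wpM2l rho_ge0 (IH (ltnW im)); lra.
apply: (le_trans (H m (leqnn m))); rewrite lerD2l.
apply: (@le_trans _ _ (m%:R * M * eps)).
  rewrite ler_wpM2r// (_ : m%:R * M = \sum_(k < m) M).
    by apply: ler_sum => k _; apply: leM; exact: ltnW.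
  by rewrite sumr_const card_ord mulr_natl.
rewrite le_eqVlt; apply/orP; left; apply/eqP; rewrite /eps; field.
by rewrite pnatr_eq0 -lt0n.
Qed.

End potential.
End drift.

(** * Discretisation of the labels *)

Local Open Scope classical_set_scope.

Lemma measure_bigsetU_le d (T : measurableType d) (R : realType)
    (mu : {measure set T -> \bar R}) (I : Type) (s : seq I) (P : pred I)
    (F : I -> set T) : (forall i, measurable (F i)) ->
  (mu (\big[setU/set0]_(i <- s | P i) F i) <= \sum_(i <- s | P i) mu (F i))%E.
Proof.
move=> mF; elim: s => [|i s IH]; first by rewrite !big_nil measure0.
rewrite !big_cons; case: ifP => _ //.
apply: le_trans (measureU2 _ _ _) _ => //; first exact: bigsetU_measurable.
by rewrite leeD2l.
Qed.

Section discretisation.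
Context (R : realType) (M : nat).
Local Notation uniform01 := (uniform_prob (@ltr01 R)).

(* Labels outside [0, 1] are sent to the first or the last slot. *)
Definition slot (x : R) : 'I_M.+1 := inord (minn (Num.truncn (M.+1%:R * x)) M).

Lemma slotE x : slot x = minn (Num.truncn (M.+1%:R * x)) M :> nat.
Proof. by rewrite inordK// ltnS geq_minr. Qed.

Lemma le_slot x y : x <= y -> (slot x <= slot y)%N.
Proof.
move=> xy; rewrite !slotE leq_min geq_minr andbT geq_min le_truncn//.
by rewrite ler_wpM2l.
Qed.

Lemma slot_geE j x : (0 < j <= M)%N ->
  (j <= slot x)%N = (j%:R / M.+1%:R <= x).
Proof.
case: j => // j /andP[_ jM].
by rewrite slotE leq_min jM andbT truncn_gt_nat ler_pdivrMr ?ltr0Sn// mulrC.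
Qed.

Lemma slot_ge_itv j : (0 < j <= M)%N ->
  [set x : R | (j <= slot x)%N] = `[j%:R / M.+1%:R, +oo[.
Proof.
by move=> jM; apply/seteqP; split => x /=; rewrite in_itv/= andbT slot_geE.
Qed.

Lemma measurable_slot_ge j : measurable [set x : measurableTypeR R | (j <= slot x)%N].
Proof.
have [->|j0] := posnP j.
  by rewrite [X in measurable X](_ : _ = setT)//; apply/seteqP.
have [jM|Mj] := leqP j M; first by rewrite slot_ge_itv ?j0.
rewrite [X in measurable X](_ : _ = set0)//; apply/seteqP; split => x //=.
by rewrite slotE => /leq_trans/(_ (geq_minr _ _)); rewrite leqNgt Mj.
Qed.

Lemma uniform_slot_ge j : (j <= M.+1)%N ->
  uniform01 [set x | (j <= slot x)%N] = (1 - j%:R / M.+1%:R)%:E.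
Proof.
move=> jM1; have [->|j0] := posnP j.
  rewrite mul0r subr0 (_ : [set x | _] = setT) ?probability_setT//.
  by apply/seteqP.
have [jM|Mj] := leqP j M; last first.
  have -> : j = M.+1 by apply/eqP; rewrite eqn_leq jM1.
  rewrite divff ?pnatr_eq0// subrr (_ : [set x | _] = set0) ?measure0//.
  apply/seteqP; split => x //=.
  by rewrite slotE => /leq_trans/(_ (geq_minr _ _)); rewrite ltnn.
rewrite slot_ge_itv ?j0// /uniform_prob integral_uniform_pdf.
have jm0 : 0 <= j%:R / M.+1%:R :> R by rewrite divr_ge0.
have jm1 : j%:R / M.+1%:R < 1 :> R.
  by rewrite ltr_pdivrMr ?ltr0Sn// mul1r ltr_nat ltnS.
have -> : `[j%:R / M.+1%:R, +oo[ `&` `[0, 1] = `[j%:R / M.+1%:R, 1] :> set R.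
  apply/seteqP; split => x /=; rewrite !in_itv/= ?andbT.
    by move=> [-> /andP[_ ->]].
  by move=> /andP[jx ->]; rewrite jx (le_trans jm0 jx).
rewrite (eq_integral (fun=> 1%:E)); last first.
  move=> x; rewrite inE/= in_itv/= /uniform_pdf => /andP[jx ->].
  by rewrite (le_trans jm0 jx)/= subr0 invr1.
by rewrite integral_cst//= lebesgue_measure_itv/= lte_fin jm1 mul1e -EFinB.
Qed.

Lemma slot_eqE (j : 'I_M.+1) : [set x : R | slot x = j] =
  [set x | (j <= slot x)%N] `\` [set x | (j.+1 <= slot x)%N].
Proof.
apply/seteqP; split => x /= => [->|[jx xj]].
  by split => //; rewrite ltnn.
by apply: val_inj => /=; apply/eqP; rewrite eqn_leq jx andbT leqNgt; apply/negP.
Qed.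

Lemma measurable_slot (j : 'I_M.+1) :
  measurable [set x : measurableTypeR R | slot x = j].
Proof. by rewrite slot_eqE; apply: measurableD; exact: measurable_slot_ge. Qed.

Lemma uniform_slot (j : 'I_M.+1) :
  uniform01 [set x | slot x = j] = (M.+1%:R^-1)%:E.
Proof.
rewrite slot_eqE.
transitivity (uniform01 [set x | (j <= slot x)%N] -
    uniform01 ([set x | (j <= slot x)%N] `&` [set x | (j.+1 <= slot x)%N]))%E.
  apply: measureD; try exact: measurable_slot_ge.
  by apply: le_lt_trans (probability_le1 _ (measurable_slot_ge j)) _; rewrite ltry.
rewrite (_ : _ `&` _ = [set x | (j.+1 <= slot x)%N]); last first.
  by apply/seteqP; split => x //= => [[]//|jx]; split => //; exact: ltnW.
rewrite !uniform_slot_ge//; last exact: ltnW.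
rewrite -EFinB -(addn1 j) natrD mulrDl mul1r; congr EFin.
ring.
Qed.

Definition edge_slot (x : bool * measurableTypeR R) : option 'I_M.+1 :=
  if x.1 then Some (slot x.2) else None.

Lemma edge_slotE a : [set x | edge_slot x = a] =
  if a is Some j then [set true] `*` [set x | slot x = j]
  else [set false] `*` setT.
Proof.
apply/seteqP; case: a => [j|]; split => -[[] x]; rewrite /edge_slot /= //.
- by move=> [].
- by move=> [_ ->].
- by move=> [].
- by move=> [].
Qed.

Lemma measurable_edge_slot a : measurable [set x | edge_slot x = a].
Proof.
rewrite edge_slotE; case: a => [j|]; apply: measurableX => //.
exact: measurable_slot.
Qed.

Lemma edge_slot_law (p : R) a : 0 <= p <= 1 ->
  (bernoulli_prob p \x uniform01)%E [set x | edge_slot x = a] =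
  (@slot_law R M.+1 p a)%:E.
Proof.
move=> p01; rewrite edge_slotE.
have tf : (true \in [set false]) = false by apply/negbTE; rewrite notin_setE.
have ft : (false \in [set true]) = false by apply/negbTE; rewrite notin_setE.
case: a => [j|] /=.
  transitivity (bernoulli_prob p [set true] * uniform01 [set x | slot x = j])%E.
    by apply: product_measure1E => //; exact: measurable_slot.
  rewrite uniform_slot bernoulli_probE// !diracE ft mem_set//=.
  by rewrite mule1 mule0 adde0 -EFinM.
transitivity (bernoulli_prob p [set false] * uniform01 setT)%E.
  exact: product_measure1E.
rewrite probability_setT bernoulli_probE// !diracE tf mem_set//=.
by rewrite !mule1 mule0 add0e.
Qed.

(** * Slots of a sample as a finite product law *)

Section sample.
Context (n : nat) (p : R) (p01 : 0 <= p <= 1).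
Local Notation E := (vpair n).

Definition slots_of (w : sample R n) : {ffun E -> option 'I_M.+1} :=
  [ffun e => edge_slot (tnth w (enum_rank e))].

Lemma slots_ofE d : [set w | slots_of w = d] =
  [set w | forall i, [set x | edge_slot x = d (enum_val i)] (tnth w i)].
Proof.
apply/seteqP; split => w /=.
  by move=> <- i; rewrite ffunE enum_valK.
by move=> h; apply/ffunP => e; rewrite ffunE h enum_rankK.
Qed.

Lemma measurable_slots_of d : measurable [set w | slots_of w = d].
Proof.
rewrite slots_ofE (_ : [set w | _] = \bigcap_(i in [set: 'I_#|{: E}|])
    ((@tnth _ _ ^~ i) @^-1` [set x | edge_slot x = d (enum_val i)])).
  apply: fin_bigcap_measurable => [|i _]; first exact: finite_finset.
  rewrite -[X in measurable X]setTI; apply: measurable_tnth => //.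
  exact: measurable_edge_slot.
by apply/seteqP; split => t /= h i; [move=> _|]; apply: h.
Qed.

(** Prescribing the slot of every edge is a rectangle event, so its probability is the product of
    the one-edge laws. *)
Lemma Fmodel_slots_of d :
  Fmodel n p [set w | slots_of w = d] = (weight (@slot_law R M.+1 p) d)%:E.
Proof.
rewrite slots_ofE /Fmodel.
rewrite (tuple_prob_rect _ (A := fun i => [set x | edge_slot x = d (enum_val i)]));
  last by move=> i; exact: measurable_edge_slot.
rewrite (eq_bigr (fun i => (slot_law p (d (enum_val i)))%:E)); last first.
  by move=> i _; exact: edge_slot_law.
rewrite prodEFin; congr EFin.
rewrite /weight (reindex (fun i : 'I_#|{: E}| => enum_val i))//.
by exists enum_rank => x _; [exact: enum_valK|exact: enum_rankK].
Qed.

Let slots_of_preimage (P : pred {ffun E -> option 'I_M.+1}) :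
  [set w | P (slots_of w)] =
  \big[setU/set0]_(d <- index_enum {ffun E -> option 'I_M.+1} | P d)
    [set w | slots_of w = d].
Proof.
rewrite -bigcup_seq_cond; apply/seteqP; split => w /=.
  by move=> Pw; exists (slots_of w) => //=; rewrite mem_index_enum.
by move=> [d /= /andP[_ Pd] ->].
Qed.

Lemma measurable_slots_pred (P : pred {ffun E -> option 'I_M.+1}) :
  measurable [set w | P (slots_of w)].
Proof.
rewrite slots_of_preimage; apply: bigsetU_measurable => d _.
exact: measurable_slots_of.
Qed.

(** Subadditivity over the fibres of [slots_of]; this carries bounds for the finite law over to the
    continuous model. *)
Lemma Fmodel_le_Ex (P : pred {ffun E -> option 'I_M.+1}) :
  (Fmodel n p [set w | P (slots_of w)] <=
   (Ex (@slot_law R M.+1 p) (fun d => (P d)%:R))%:E)%E.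
Proof.
rewrite slots_of_preimage.
apply: (le_trans (measure_bigsetU_le _ _ _ _)); first exact: measurable_slots_of.
rewrite (eq_bigr (fun d => (weight (slot_law p) d)%:E)); last first.
  by move=> d _; exact: Fmodel_slots_of.
rewrite sumEFin lee_fin /Ex big_mkcond; apply: ler_sum => d _.
by case: (P d); rewrite ?mulr1 ?mulr0.
Qed.

End sample.
End discretisation.

(** * Exploration by slots versus temporal paths *)

Section source_reached.
Context (R : realType) (M n : nat) (x : sample R n).
Local Notation E := (vpair n).
Local Notation G := (sample_tgraph x).
Local Notation d := (slots_of M x).
Implicit Types (e : E) (u v w : 'I_n).

Lemma tg_time_edge e u w : val e = [set u; w]%SET ->
  tg_time G u w = (tnth x (enum_rank e)).2.
Proof. by move=> eE; rewrite /tg_time /= /sample_label -eE valK. Qed.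

Lemma tg_adj_edge e u w : val e = [set u; w]%SET ->
  tg_adj G u w = (tnth x (enum_rank e)).1.
Proof.
move=> eE; rewrite /tg_adj /= -eE; apply/imsetP/idP => [[e']|xe].
  by rewrite inE => xe' /val_inj ->.
by exists e => //; rewrite inE.
Qed.

Lemma tg_adjP u w : tg_adj G u w -> exists e, val e = [set u; w]%SET.
Proof. by move=> /imsetP[e _ ->]; exists e. Qed.

Lemma fires_slots_of e u w j : val e = [set u; w]%SET ->
  fires d j e = tg_adj G u w && (slot M (tg_time G u w) == j :> nat).
Proof.
move=> eE; rewrite (tg_adj_edge eE) (tg_time_edge eE) /fires ffunE /edge_slot.
by case: (tnth _ _).1.
Qed.

(** The induction carries two facts about the path: its vertices are already reached, so appending a
    new vertex keeps it simple; its labels lie in slots below [j], so appending an edge of slot [j]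
    keeps them sorted. *)
Lemma reached_temporal_path v j u : u \in reached d v j ->
  exists s, [/\ temporal_path G v u s, {subset v :: s <= reached d v j} &
    all (fun t => (slot M t < j)%N) (pairmap (tg_time G) v s)].
Proof.
elim: j u => [|j IH] u.
  rewrite inE => /eqP ->; exists [::]; split => //.
    by rewrite /temporal_path /= eqxx.
  by move=> y; rewrite !inE.
have sub := fintype.subsetP (reachedS d v j).
have old : u \in reached d v j -> exists s, [/\ temporal_path G v u s,
    {subset v :: s <= reached d v j.+1} &
    all (fun t => (slot M t < j.+1)%N) (pairmap (tg_time G) v s)].
  move=> /IH[s [ts vs al]]; exists s; split => //.
    by move=> y /vs /sub.
  by apply: sub_all al => t /=; apply: ltnW.
case: (boolP (u \in reached d v j)) => [/old//|nu].
rewrite /= inE (negbTE nu) /= => /bigcupP[e /andP[fe ce] ue].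
move: ce => /crossesP[a [b [aS bS eE]]].
have ub : u = b.
  by move: ue; rewrite eE !inE => /orP[] /eqP // ua; rewrite ua aS in nu.
subst b; have [s [/and4P[pt /eqP la un so] vs al]] := IH _ aS.
move: fe; rewrite (fires_slots_of _ eE) => /andP[adj /eqP sl].
have pE : pairmap (tg_time G) v (rcons s u) =
    rcons (pairmap (tg_time G) v s) (tg_time G a u).
  by rewrite -cats1 pairmap_cat /= la cats1.
exists (rcons s u); split.
- apply/and4P; split.
  + by rewrite rcons_path pt la.
  + by rewrite last_rcons.
  + rewrite -rcons_cons rcons_uniq un andbT.
    by apply: contra nu => /vs.
  + rewrite pE (sorted_pairwise le_trans) pairwise_rcons.
    rewrite -(sorted_pairwise le_trans) so andbT; apply: sub_all al => t /= tj.
    rewrite leNgt; apply/negP => /ltW/(le_slot M); rewrite sl.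
    by rewrite leqNgt tj.
- move=> y; rewrite -rcons_cons mem_rcons inE => /orP[/eqP ->|/vs /sub//].
  apply: (fintype.subsetP (finset.subsetUr _ _)).
  by apply/bigcupP; exists e => //; rewrite (fires_slots_of _ eE) adj sl eqxx/=;
     apply/crossesP; exists a, u.
- rewrite pE all_rcons sl ltnSn /=.
  by apply: sub_all al => t /=; apply: ltnW.
Qed.

Lemma reached_temporal_source v j :
  reached d v j = [set: 'I_n]%SET -> temporal_source G v.
Proof.
move=> full w _; have [|s [ts _ _]] := @reached_temporal_path v j w.
  by rewrite full inE.
by exists s.
Qed.

(** Without collisions the slots along a temporal path strictly increase, so the exploration follows
    it edge by edge. *)
Lemma temporal_path_reached v u s : (forall j, (j < M.+1)%N -> ~~ collides d j) ->
  temporal_path G v u s -> u \in reached d v M.+1.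
Proof.
move=> nc /and4P[pt /eqP <- un so].
(* Generalised to a suffix of the path: its start [a] is reached by stage [k], and its first edge
   lies in slot [k] or later. *)
suff H a k : a \in reached d v k -> (k <= M.+1)%N -> path (tg_adj G) a s ->
    uniq (a :: s) -> sorted <=%R (pairmap (tg_time G) a s) ->
    (if s is b :: _ then (k <= slot M (tg_time G a b))%N else true) ->
    last a s \in reached d v M.+1.
  apply: (H v 0%N) => //; first by rewrite inE.
  by case: (s).
elim: s a k {pt un so u} => [|b s IH] a k ak kM.
  by move=> _ _ _ _; exact: (fintype.subsetP (reached_mono d v kM)).
move=> /andP[ab pb] un so kab.
set l := slot M (tg_time G a b) in kab.
have [e eE] := tg_adjP ab.
have fe : fires d l e by rewrite (fires_slots_of _ eE) ab eqxx.
have al : a \in reached d v l by exact: (fintype.subsetP (reached_mono d v kab)).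
have bl : b \in reached d v l.+1.
  case: (boolP (b \in reached d v l)) => bl.
    exact: (fintype.subsetP (reachedS d v l)).
  apply: (fintype.subsetP (finset.subsetUr _ _)); apply/bigcupP; exists e.
    by rewrite fe; apply/crossesP; exists a, b.
  by rewrite eE !inE eqxx orbT.
apply: (IH b l.+1 bl) => //.
- by move: un; rewrite /= => /andP[].
- exact: path_sorted so.
(* The next edge lies strictly after slot [l]: an equal slot would be a collision, since the edges
   [ab] and [bc] differ on a simple path. *)
case: s {IH} pb un so => [//|c s] /= /andP[bc _] un /andP[abc _].
rewrite ltn_neqAle le_slot// andbT.
have [e' eE'] := tg_adjP bc.
apply: contra (nc l (ltn_ord _)) => /eqP ll.
apply/existsP; exists e; apply/existsP; exists e'; rewrite fe andTb.
rewrite (fires_slots_of _ eE') bc -ll eqxx !andbT.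
apply: contraTneq un => ee'.
have : a \in [set b; c]%SET by rewrite -eE' -ee' eE !inE eqxx.
by rewrite !inE => /orP[] /eqP ->; rewrite eqxx ?orbT.
Qed.

Lemma temporal_source_reached v : (forall j, (j < M.+1)%N -> ~~ collides d j) ->
  temporal_source G v -> reached d v M.+1 = [set: 'I_n]%SET.
Proof.
move=> nc sv; apply/finset.setP => u; rewrite [RHS]inE.
have [->|uv] := eqVneq u v.
  by apply: (fintype.subsetP (reached_mono d v (leq0n _))); rewrite inE.
by have [s /(temporal_path_reached nc)] := sv u uv.
Qed.

End source_reached.

(** * Tail bounds for a fixed number of vertices *)

Lemma le_of_le_add_div (R : realType) (a b K : R) (m0 : nat) :
  (forall m, (m0 <= m)%N -> a <= b + K / m.+1%:R) -> a <= b.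
Proof.
move=> H; rewrite leNgt; apply/negP => ba.
have ab0 : 0 < a - b by rewrite subr_gt0.
have K0 : 0 <= `|K| / (a - b) by rewrite divr_ge0// ltW.
have /archi_boundP := K0; set k := Num.bound _ => Kk.
have := H (maxn m0 k) (leq_maxl _ _); rewrite leNgt => /negP; apply.
rewrite -ltrBrDl ltr_pdivrMr ?ltr0Sn//; apply: le_lt_trans (ler_norm K) _.
rewrite mulrC -ltr_pdivrMr//; apply: lt_le_trans Kk _.
by rewrite ler_nat; apply: leq_trans (leqnSn _); exact: leq_maxr.
Qed.

Section fixed_size.
Context (R : realType) (n : nat) (p : R) (p01 : 0 <= p <= 1).
Local Notation E := (vpair n).
Local Notation Exp m := (Ex (@slot_law R m p)).

(** The event [A] does not depend on the number of slots, so the discretisation error can be sent to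
    0. *)
Let Fmodel_limit (A : set (sample R n)) (b K : R) m0 :
  (forall m, (m0 <= m)%N -> (Fmodel n p A <= (b + K / m.+1%:R)%:E)%E) ->
  measurable A -> (Fmodel n p A <= b%:E)%E.
Proof.
move=> H mA; have fA : Fmodel n p A \is a fin_num by exact: fin_num_measure.
rewrite -(fineK fA) lee_fin; apply: (@le_of_le_add_div _ _ _ K m0) => m mm.
by rewrite -lee_fin fineK// H.
Qed.

Let msource := @measurable_has_temporal_source R n.

(** * A decreasing potential: one vertex reaches all others *)

Section lower_tail.

(** For [0 < k < n], [k (n - k)] times the rate is [n / 4], so the relative drift of the potential
    below is bounded uniformly in [k]. The divisor 4 keeps the rate at most 1/2. *)
Definition escape_rate k : R := n%:R / (4 * (k * (n - k))%:R).

(* Chosen so that [expR (- escape_exponent k) <= 1 - escape_rate k]. *)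
Definition escape_exponent k : R := escape_rate k + 2 * escape_rate k ^+ 2.

(** Shaped for Markov's inequality: at least 1 while a vertex is missing, and 0 once all are
    reached. *)
Definition escape_potential k : R :=
  if (k < n)%N then expR (\sum_(k <= j < n) escape_exponent j) else 0.

Lemma escape_rate_ge0 k : 0 <= escape_rate k.
Proof. by rewrite divr_ge0// mulr_ge0. Qed.

Lemma escape_rateE k : (0 < k < n)%N ->
  escape_rate k = (k%:R^-1 + (n - k)%:R^-1) / 4.
Proof.
move=> /andP[k0 kn]; rewrite /escape_rate natrM natrB ?(ltnW kn)//.
have : (k%:R != 0 :> R) by rewrite pnatr_eq0 -lt0n.
have : n%:R - k%:R != 0 :> R by rewrite subr_eq0 eqr_nat gtn_eqF.
by move=> h1 h2; field; rewrite h1 h2.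
Qed.

Lemma escape_rate_le k : (0 < k < n)%N -> escape_rate k <= 2^-1.
Proof.
move=> kn; rewrite escape_rateE//; move/andP: kn => [k0 kn].
have h1 : k%:R^-1 <= 1 :> R by rewrite invf_le1 ?ltr0n// ler1n.
have h2 : (n - k)%:R^-1 <= 1 :> R by rewrite invf_le1 ?ltr0n ?ler1n subn_gt0.
lra.
Qed.

Let exponent_ge0 k : 0 <= escape_exponent k.
Proof. by rewrite addr_ge0 ?mulr_ge0 ?exprn_ge0// escape_rate_ge0. Qed.

Lemma escape_potential_ge0 k : 0 <= escape_potential k.
Proof. by rewrite /escape_potential; case: ifP => // _; rewrite expR_ge0. Qed.

Lemma escape_potential_ge1 k : (k < n)%N -> 1 <= escape_potential k.
Proof.
by move=> kn; rewrite /escape_potential kn -expR0 ler_expR sumr_ge0.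
Qed.

Lemma escape_potential_decr k : escape_potential k.+1 <= escape_potential k.
Proof.
have [kn|kn] := ltnP k.+1 n; last first.
  by rewrite {1}/escape_potential ltnNge kn escape_potential_ge0.
rewrite /escape_potential kn ltnW// ler_expR [leRHS]big_ltn; last exact: ltnW.
by rewrite lerDr.
Qed.

Lemma escape_potential_le k : escape_potential k <= escape_potential 0.
Proof. by elim: k => // k; apply: le_trans; exact: escape_potential_decr. Qed.

(** Because [(1 - x) (1 + x + 2 x^2) = 1 + x^2 (1 - 2 x)], which is at least 1 on this range. *)
Lemma expRN_escape (x : R) : 0 <= x <= 2^-1 -> expR (- (x + 2 * x ^+ 2)) <= 1 - x.
Proof.
move=> /andP[x0 x1]; rewrite expRN.
rewrite -[leLHS]mul1r ler_pdivrMr ?expR_gt0//.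
apply: le_trans (_ : (1 - x) * (1 + (x + 2 * x ^+ 2)) <= _); last first.
  by rewrite ler_wpM2l ?expR_ge1Dx//; lra.
have := mulr_ge0 (exprn_ge0 2 x0) (_ : 0 <= 1 - 2 * x); rewrite expr2.
move=> /(_ _); have h : 0 <= 1 - 2 * x by lra.
move=> /(_ h); nra.
Qed.

Lemma escape_potential_drop k : (0 < k < n)%N ->
  escape_potential k.+1 - escape_potential k <= - (escape_rate k * escape_potential k).
Proof.
move=> kn; have x0 := escape_rate_ge0 k; have x1 := escape_rate_le kn.
suff : escape_potential k.+1 <= (1 - escape_rate k) * escape_potential k by lra.
move/andP: kn => [k0 kn]; rewrite /escape_potential kn.
case: ifP => [k1n|_]; last by rewrite mulr_ge0 ?expR_ge0//; lra.
rewrite [in leRHS]big_ltn// [in leRHS]expRD mulrA ler_peMl ?expR_ge0//.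
have := @expRN_escape (escape_rate k); rewrite x0 x1 => /(_ isT).
rewrite -/(escape_exponent k) expRN => /(ler_wpM2r (expR_ge0 (escape_exponent k))).
by rewrite mulVf// gt_eqF// expR_gt0.
Qed.

(** It suffices to follow one vertex. By Markov's inequality, it misses some vertex with probability
    at most the final expected potential, which contracts by [1 - n p / (4 m)] per slot up to the
    collision error. *)
Lemma no_source_le : (0 < n)%N ->
  (Fmodel n p [set w | ~ has_temporal_source (sample_tgraph w)] <=
   (expR (- (n%:R * p / 4)) * escape_potential 1)%:E)%E.
Proof.
move=> n0; case/andP: (p01) => p0 p1; pose v : 'I_n := Ordinal n0.
pose s := n%:R * p / 4.
have s0 : 0 <= s by rewrite divr_ge0// mulr_ge0.
pose K := 1 * ((1 + #|{: E}|%:R) * escape_potential 0) * #|{: E}|%:R ^+ 2.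
(* At least [n] slots are taken, so that the contraction factor is nonnegative. *)
apply: (@Fmodel_limit _ _ K n); last first.
  rewrite (_ : [set w | _] = ~` [set w | has_temporal_source (sample_tgraph w)])//.
  exact: measurableC.
move=> M nM.
pose full (d : {ffun E -> option 'I_M.+1}) := reached d v M.+1 == [set: 'I_n]%SET.
have source_full : (Fmodel n p [set w | ~ has_temporal_source (sample_tgraph w)] <=
    Fmodel n p [set w | ~~ full (slots_of M w)])%E.
  apply: le_measure; rewrite ?inE.
  - rewrite (_ : [set w | _] = ~` [set w | has_temporal_source (sample_tgraph w)])//.
    exact: measurableC.
  - exact: (measurable_slots_pred (fun d => ~~ full d)).
  - move=> w /= nw; apply/negP => /eqP fw; apply: nw; exists v.
    exact: reached_temporal_source fw.
apply: (le_trans source_full).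
apply: (le_trans (Fmodel_le_Ex p01 (fun d => ~~ full d))); rewrite lee_fin.
have sM : s / M.+1%:R <= 1.
  rewrite ler_pdivrMr ?ltr0Sn// mul1r; apply: (@le_trans _ _ (n%:R : R)).
    have : n%:R * p <= n%:R by rewrite ler_piMr.
    by have : 0 <= n%:R :> R by []; rewrite /s; lra.
  by rewrite ler_nat leqW.
apply: (@le_trans _ _ (Exp M.+1 (fun d => escape_potential #|reached d v M.+1|))).
  apply: (ler_Ex (slot_law_ge0 p01)) => d; rewrite /full.
  case: eqP => [_|/eqP nf]; first exact: escape_potential_ge0.
  apply: escape_potential_ge1; rewrite -[X in (_ < X)%N]card_ord -cardsT.
  by apply: proper_card; rewrite finset.properEneq nf finset.subsetT.
apply: (le_trans (@Ex_potential R n M.+1 p p01 isT v escape_potential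
  (escape_potential 0) p (- (s / M.+1%:R)) _ _ _ _ 1 _)).
- by move=> k; rewrite escape_potential_ge0 escape_potential_le.
- by rewrite lerN2.
(* The potential decreases, so the lower bound on firing, applied to the opposite increments, bounds
   the drift from above. *)
- move=> j e; pose F k := escape_potential k - escape_potential k.+1.
  have F0 k : 0 <= F k by rewrite subr_ge0 escape_potential_decr.
  have := @Ex_fires_ge R n M.+1 p p01 isT v j e F F0.
  set A := Ex _ _; set B := Ex _ _; set C := Ex _ _; set D := Ex _ _.
  have -> : A = - D.
    by rewrite -mulN1r -ExZ; apply: eq_Ex => d; rewrite /F; ring.
  have -> : B = - C.
    by rewrite -mulN1r -ExZ; apply: eq_Ex => d; rewrite /F; ring.
  by rewrite mulrN lerN2.
- move=> k /andP[k0 kn]; have [kn'|kn'] := ltnP k n; last first.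
    have -> : k = n by apply/eqP; rewrite eqn_leq kn kn'.
    by rewrite subnn muln0 mul0r mulr0 /escape_potential ltnn mulr0.
  have := @escape_potential_drop k; rewrite k0 kn' => /(_ isT) dr.
  have h1 : 0 <= p / M.+1%:R * (k * (n - k))%:R :> R by rewrite mulr_ge0// divr_ge0.
  rewrite mulrA; apply: (le_trans (ler_wpM2l h1 dr)).
  rewrite le_eqVlt; apply/orP; left; apply/eqP; rewrite /s /escape_rate.
  have : (k * (n - k))%:R != 0 :> R by rewrite pnatr_eq0 muln_eq0; lia.
  have : M.+1%:R != 0 :> R by rewrite pnatr_eq0.
  move=> h2 h3; field.
  by rewrite nat1r h2 /=; move: h3; rewrite natrM mulf_eq0 negb_or andbC.
- move=> i _; apply: exprn_ile1; first by rewrite subr_ge0.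
  by rewrite gerDl oppr_le0 divr_ge0.
rewrite -/K lerD2r ler_wpM2r ?escape_potential_ge0//.
rewrite (_ : - (n%:R * p / 4) = - (s / M.+1%:R) * M.+1%:R); last first.
  by rewrite mulNr divfK ?pnatr_eq0.
rewrite expRM_natr lerXn2r ?nnegrE ?expR_ge0 ?expR_ge1Dx//.
by rewrite subr_ge0.
Qed.

End lower_tail.

(** * An increasing potential: no vertex reaches all others *)

Section upper_tail.
Context (c : R) (c_ge0 : 0 <= c).

(* Equal to 0 for [n <= k], so that [spread_potential] is constant from [n] on. *)
Definition spread_rate k : R := n%:R / (k * (n - k))%:R.

(** For [0 < k < n], [k (n - k)] times the relative increment at [k] is [c n], whatever [k] is. The
    parameter [c] is left free for a later choice. *)
Definition spread_potential k : R := \prod_(1 <= j < k) (1 + c * spread_rate j).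

Lemma spread_rate_ge0 k : 0 <= spread_rate k.
Proof. exact: divr_ge0. Qed.

Lemma spread_potentialS k : (0 < k)%N ->
  spread_potential k.+1 = spread_potential k * (1 + c * spread_rate k).
Proof. by move=> k0; rewrite /spread_potential big_nat_recr. Qed.

Lemma spread_potential_ge1 k : 1 <= spread_potential k.
Proof.
rewrite /spread_potential.
elim/big_ind: _ => // [x y x1 y1|j _]; first by rewrite -[1]mulr1 ler_pM.
by rewrite lerDl mulr_ge0// spread_rate_ge0.
Qed.

Let spread_potential_ge0 k : 0 <= spread_potential k.
Proof. exact: le_trans (spread_potential_ge1 k). Qed.

Lemma spread_potential_incr k : spread_potential k <= spread_potential k.+1.
Proof.
case: k => [|k]; first by rewrite /spread_potential !big_geq.
by rewrite (spread_potentialS (ltn0Sn k)) ler_peMr// lerDl mulr_ge0// spread_rate_ge0.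
Qed.

Lemma spread_potential_le k : (0 < n)%N -> spread_potential k <= spread_potential n.
Proof.
move=> n0; have [kn|/ltnW nk] := leqP k n.
  rewrite -(subnK kn); elim: (n - k)%N => [//|i IH].
  by apply: le_trans IH _; rewrite addSn spread_potential_incr.
rewrite -(subnK nk); elim: (k - n)%N => [//|i IH].
rewrite addSn spread_potentialS ?addn_gt0 ?n0 ?orbT//.
rewrite /spread_rate (_ : (n - (i + n) = 0)%N); last first.
  by apply/eqP; rewrite subn_eq0 leq_addl.
by rewrite muln0 invr0 !mulr0 addr0 mulr1.
Qed.

(** Markov's inequality for the potential, which equals [spread_potential n] on the full set; the
    factors [1 + s / m] multiply to at most [expR s]. *)
Lemma Ex_reached_full v M s : p < 1 -> s = c * n%:R * (p / (1 - p)) ->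
  Exp M.+1 (fun d => (reached d v M.+1 == [set: 'I_n]%SET)%:R) <=
  (expR s + expR s * ((1 + #|{: E}|%:R) * spread_potential n) * #|{: E}|%:R ^+ 2
     / M.+1%:R) / spread_potential n.
Proof.
move=> p1 sE; have p0 : 0 <= p by case/andP: p01.
have n0 : (0 < n)%N by apply: leq_ltn_trans (ltn_ord v).
have r0 : 0 <= p / (1 - p) by rewrite divr_ge0// subr_ge0 ltW.
have s0 : 0 <= s by rewrite sE mulr_ge0// mulr_ge0.
have rho i : (i <= M.+1)%N -> (1 + s / M.+1%:R) ^+ i <= expR s.
  move=> iM; apply: (@le_trans _ _ (expR (s / M.+1%:R) ^+ i)).
    by rewrite lerXn2r ?nnegrE ?expR_ge0 ?expR_ge1Dx// addr_ge0// divr_ge0.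
  rewrite -expRM_natr ler_expR mulrAC ler_pdivrMr ?ltr0Sn//.
  by rewrite ler_wpM2l// ler_nat.
rewrite ler_pdivlMr; last exact: lt_le_trans (spread_potential_ge1 n).
rewrite mulrC -ExZ.
apply: (@le_trans _ _ (Exp M.+1 (fun d => spread_potential #|reached d v M.+1|))).
  apply: (ler_Ex (slot_law_ge0 p01)) => d.
  case: eqP => [->|_]; last by rewrite mulr0.
  by rewrite mulr1 cardsT card_ord.
apply: (le_trans (@Ex_potential R n M.+1 p p01 isT v spread_potential
  (spread_potential n) (p / (1 - p)) (s / M.+1%:R) _ _ _ _ (expR s) rho)).
- by move=> k; rewrite spread_potential_ge0 spread_potential_le.
- by apply: (@le_trans _ _ 0); rewrite ?divr_ge0// oppr_le0.
- move=> j e; pose F k := spread_potential k.+1 - spread_potential k.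
  have F0 k : 0 <= F k by rewrite subr_ge0 spread_potential_incr.
  exact: (@Ex_fires_le R n M.+1 p p01 isT v j e F F0 p1).
- move=> k /andP[k0 kn]; rewrite spread_potentialS//.
  have -> : spread_potential k * (1 + c * spread_rate k) - spread_potential k =
      c * spread_rate k * spread_potential k by ring.
  have kk : (k * (n - k))%:R * spread_rate k <= n%:R.
    rewrite /spread_rate; have [->|h] := eqVneq ((k * (n - k))%:R : R) 0.
      by rewrite mul0r.
    by rewrite mulrC divfK.
  have -> : p / (1 - p) / M.+1%:R * ((k * (n - k))%:R *
      (c * spread_rate k * spread_potential k)) =
      ((k * (n - k))%:R * spread_rate k) *
      (p / (1 - p) / M.+1%:R * c * spread_potential k) by ring.
  apply: (@le_trans _ _ (n%:R * (p / (1 - p) / M.+1%:R * c * spread_potential k))).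
    by rewrite ler_wpM2r// mulr_ge0// mulr_ge0// divr_ge0.
  by rewrite le_eqVlt; apply/orP; left; apply/eqP; rewrite sE; ring.
apply: lerD => //.
by rewrite /spread_potential big_geq// mulr1; apply: rho.
Qed.

(** Off collisions the reached set of a source is full, so a union bound over the [n] starting
    vertices applies. Collisions add [O(1/m)] in total and vanish in the limit. *)
Lemma source_le : p < 1 ->
  (Fmodel n p [set w | has_temporal_source (sample_tgraph w)] <=
   (n%:R * (expR (c * n%:R * (p / (1 - p))) / spread_potential n))%:E)%E.
Proof.
move=> p1; set s := c * n%:R * (p / (1 - p)).
pose K := expR s * ((1 + #|{: E}|%:R) * spread_potential n) * #|{: E}|%:R ^+ 2.
apply: (@Fmodel_limit _ _
  (#|{: E}|%:R ^+ 2 + n%:R * (K / spread_potential n)) 0); last exact: msource.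
move=> M _.
pose bad (d : {ffun E -> option 'I_M.+1}) := [exists j : 'I_M.+1, collides d j]
  || [exists v, reached d v M.+1 == [set: 'I_n]%SET].
have source_bad : (Fmodel n p [set w | has_temporal_source (sample_tgraph w)] <=
    Fmodel n p [set w | bad (slots_of M w)])%E.
  apply: le_measure; rewrite ?inE; first exact: msource.
    exact: (measurable_slots_pred bad).
  move=> w /= [v sv]; rewrite /bad.
  case: (boolP [exists j : 'I_M.+1, collides (slots_of M w) j]) => //= nc.
  apply/existsP; exists v; apply/eqP; apply: temporal_source_reached => // j jM.
  by apply: contra nc => cj; apply/existsP; exists (Ordinal jM).
apply: (le_trans source_bad); apply: (le_trans (Fmodel_le_Ex p01 bad)).
rewrite lee_fin.
apply: (@le_trans _ _ (Exp M.+1 (fun d => \sum_(j < M.+1) (collides d j)%:R +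
    \sum_v (reached d v M.+1 == [set: 'I_n]%SET)%:R))).
  apply: (ler_Ex (slot_law_ge0 p01)) => d.
  have h1 : 0 <= \sum_(j < M.+1) (collides d j)%:R :> R by exact: sumr_ge0.
  have h2 : 0 <= \sum_v (reached d v M.+1 == [set: 'I_n]%SET)%:R :> R by exact: sumr_ge0.
  rewrite /bad; case: (boolP [exists j : 'I_M.+1, collides d j]) => [/existsP[j cj]|_] /=.
    by rewrite (bigD1 j)//= cj -!addrA lerDl addr_ge0// sumr_ge0.
  case: (boolP [exists v, _]) => [/existsP[v fv]|_] /=; last exact: addr_ge0.
  by rewrite [X in _ + X](bigD1 v)//= fv addrCA lerDl addr_ge0// sumr_ge0.
rewrite ExD !Ex_sum.
apply: (@le_trans _ _ (\sum_(j < M.+1) (#|{: E}|%:R ^+ 2 / M.+1%:R ^+ 2) +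
  \sum_(v < n) ((expR s + K / M.+1%:R) / spread_potential n))).
  apply: lerD; apply: ler_sum => i _; first exact: Ex_collides.
  exact: Ex_reached_full.
rewrite !sumr_const !card_ord -[X in X + _]mulr_natl -[X in _ + X]mulr_natl.
have M0 : M.+1%:R != 0 :> R by rewrite pnatr_eq0.
have -> : M.+1%:R * (#|{: E}|%:R ^+ 2 / M.+1%:R ^+ 2) = #|{: E}|%:R ^+ 2 / M.+1%:R :> R.
  by rewrite mulrC expr2 invfM mulrA divfK.
by rewrite le_eqVlt; apply/orP; left; apply/eqP; ring.
Qed.

End upper_tail.
End fixed_size.

(** * Size of the potentials *)

Section asymptotics.
Context (R : realType).

Lemma inv_le_ln_diff (x : R) : 0 < x -> (x + 1)^-1 <= ln (x + 1) - ln x.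
Proof.
move=> x0; have x1 : 0 < x + 1 by rewrite addr_gt0.
rewrite -lerN2 opprB -ln_div ?posrE//.
have -> : x / (x + 1) = 1 + - (x + 1)^-1 by field; rewrite gt_eqF.
apply: le_ln1Dx; rewrite ltrN2 invf_lt1//; lra.
Qed.

Lemma ln_diff_le_inv (x : R) : 0 < x -> ln (x + 1) - ln x <= x^-1.
Proof.
move=> x0; rewrite -ln_div ?posrE ?addr_gt0//.
have -> : (x + 1) / x = 1 + x^-1 by field; rewrite gt_eqF.
by apply: le_ln1Dx; apply: (@lt_trans _ _ 0); rewrite ?oppr_lt0 ?invr_gt0.
Qed.

Lemma harmonic_le_ln n : (0 < n)%N ->
  \sum_(1 <= k < n.+1) k%:R^-1 <= 1 + ln n%:R :> R.
Proof.
elim: n => // -[_ _|n IH _].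
  by rewrite big_nat1 ln1 addr0 invr1.
rewrite big_nat_recr//=; apply: (le_trans (lerD (IH isT) (lexx _))).
rewrite -addrA lerD2l -lerBrDl; have := inv_le_ln_diff (ltr0Sn R n).
by rewrite natr1.
Qed.

(** The subtracted [1 / n] makes the induction close, by [1 / (a + 1)^2 <= 1 / a - 1 / (a + 1)]. *)
Lemma sum_inv_sqr_le n : (0 < n)%N ->
  \sum_(1 <= k < n.+1) k%:R^-1 ^+ 2 <= 2 - n%:R^-1 :> R.
Proof.
elim: n => // -[_ _|n IH _].
  by rewrite big_nat1 invr1 expr1n; lra.
rewrite big_nat_recr//=; apply: (le_trans (lerD (IH isT) (lexx _))).
rewrite -[n.+2%:R]natr1; have a0 : 0 < n.+1%:R :> R by [].
move: (n.+1%:R) a0 => a a0; have a1 : 0 < a + 1 by lra.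
rewrite -subr_ge0.
have -> : 2 - (a + 1)^-1 - (2 - a^-1 + (a + 1)^-1 ^+ 2) =
   (a + 1)^-1 ^+ 2 * a^-1 by field; rewrite !gt_eqF.
by rewrite mulr_ge0// ?exprn_ge0// invr_ge0 ltW.
Qed.

(** By the symmetry between [k] and [n - k], the rates add up to half a harmonic sum, about
    [ln n / 2]; their squares add a bounded amount. *)
Lemma escape_potential1_le n : (1 < n)%N ->
  escape_potential R n 1 <= expR (ln n%:R / 2 + 3 / 2).
Proof.
case: n => // n n0; rewrite /escape_potential n0 ler_expR.
have rev (F : nat -> R) :
    \sum_(1 <= k < n.+1) F (n.+1 - k)%N = \sum_(1 <= k < n.+1) F k.
  by rewrite [RHS]big_nat_rev /=; apply: eq_big_nat => k _; rewrite add1n subSS.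
pose H := \sum_(1 <= k < n.+1) k%:R^-1 : R.
pose Q := \sum_(1 <= k < n.+1) k%:R^-1 ^+ 2 : R.
apply: (@le_trans _ _ (H / 2 + Q / 2)).
  have -> : H / 2 + Q / 2 = \sum_(1 <= k < n.+1)
      ((k%:R^-1 + (n.+1 - k)%:R^-1) / 4 + (k%:R^-1 ^+ 2 + (n.+1 - k)%:R^-1 ^+ 2) / 4).
    rewrite big_split /= -!mulr_suml !big_split /=.
    rewrite (rev (fun k => k%:R^-1)) (rev (fun k => k%:R^-1 ^+ 2)) -/H -/Q; lra.
  apply: ler_sum_nat => k kn; rewrite /escape_exponent escape_rateE// lerD2l.
  (* The quadratic part is [2 ((a + b) / 4)^2 <= (a^2 + b^2) / 4]. *)
  move: (k%:R^-1) ((n.+1 - k)%:R^-1) => a b.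
  have := sqr_ge0 (a - b); lra.
have hH : H <= 1 + ln n%:R by apply: harmonic_le_ln.
have hQ : Q <= 2 - n%:R^-1 by apply: sum_inv_sqr_le.
have hL : ln n%:R <= ln n.+1%:R :> R by rewrite ler_ln ?posrE ?ltr0n// ler_nat.
have : 0 <= n%:R^-1 :> R by rewrite invr_ge0.
lra.
Qed.

(** Compare with [P], the product of the [1 + 2 c / k], which grows like [n^(2 c)]: each factor is
    at least the exponential of [2 c] times an increment of [ln (k + 2 c)], and these increments
    telescope. *)
Lemma spread_potential_ge n (c : R) : (0 < n)%N -> 0 <= c ->
  expR (2 * c * (ln n%:R - ln (1 + 2 * c))) <= spread_potential n c n.
Proof.
move=> n0 c0; set P := \prod_(1 <= k < n) (1 + 2 * c / k%:R).
have P_ge : expR (2 * c * (ln n%:R - ln (1 + 2 * c))) <= P.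
  apply: (@le_trans _ _ (expR (\sum_(1 <= k < n)
      (2 * c * (ln (k.+1%:R + 2 * c) - ln (k%:R + 2 * c)))))).
    rewrite ler_expR -mulr_sumr telescope_sumr// ler_wpM2l ?mulr_ge0//.
    rewrite lerD2r ler_ln ?posrE ?ltr0n//; first by rewrite lerDl mulr_ge0.
    by rewrite ltr_pwDl ?ltr0n// mulr_ge0.
  rewrite expR_sum big_nat [leRHS]big_nat; apply: ler_prod => k /andP[k0 kn].
  rewrite expR_ge0/=.
  have k0' : 0 < k%:R :> R by rewrite ltr0n.
  have kc : 0 < k%:R + 2 * c by rewrite ltr_pwDl// mulr_ge0.
  have := ln_diff_le_inv kc; rewrite addrAC natr1 => lk.
  apply: (@le_trans _ _ (expR (2 * c / (k%:R + 2 * c)))).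
    by rewrite ler_expR ler_wpM2l// mulr_ge0.
  (* As an inverse, the factor reduces the claim to [1 - y <= expR (- y)] with
     [y = 2 c / (k + 2 c)]. *)
  have -> : 1 + 2 * c / k%:R = (1 - 2 * c / (k%:R + 2 * c))^-1.
    by field; rewrite ?gt_eqF//= ?addrK ?gt_eqF.
  rewrite -[expR _]invrK -expRN lef_pV2 ?posrE ?expR_gt0//.
    exact: expR_ge1Dx.
  rewrite subr_gt0 ltr_pdivrMr// mul1r; lra.
apply: (le_trans P_ge).
have P_ge0 : 0 <= P by apply: prodr_ge0 => k _; rewrite addr_ge0// divr_ge0// mulr_ge0.
have S_ge0 : 0 <= spread_potential n c n by apply: le_trans (spread_potential_ge1 n c0 n).
(* Pair the factors [k] and [n - k]: [(1 + 2 a) (1 + 2 b) <= (1 + a + b) ^ 2]. *)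
rewrite -ler_sqr ?nnegrE//.
have -> : P ^+ 2 = \prod_(1 <= k < n)
    ((1 + 2 * c / k%:R) * (1 + 2 * c / (n - k)%:R)).
  rewrite big_split /= expr2 -/P; congr (_ * _); rewrite /P big_nat_rev /=.
  by apply: eq_big_nat => k _; rewrite add1n subSS.
rewrite /spread_potential -prodrXl big_nat [leRHS]big_nat; apply: ler_prod => k kn.
have -> : spread_rate R n k = k%:R^-1 + (n - k)%:R^-1.
  have := @escape_rateE R n k kn; rewrite /escape_rate /spread_rate invfM.
  by move: ((k * (n - k))%:R^-1) (k%:R^-1) ((n - k)%:R^-1) => a b d; lra.
have : 0 <= k%:R^-1 :> R by rewrite invr_ge0.
have : 0 <= (n - k)%:R^-1 :> R by rewrite invr_ge0.
move: (k%:R^-1) ((n - k)%:R^-1) => a b b0 a0.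
rewrite mulr_ge0 ?addr_ge0 ?mulr_ge0//=.
rewrite -subr_ge0.
have -> : (1 + c * (a + b)) ^+ 2 - (1 + 2 * c * a) * (1 + 2 * c * b) =
  (c * (a - b)) ^+ 2 by ring.
exact: sqr_ge0.
Qed.

End asymptotics.

(** * The threshold *)

Section threshold.
Context (R : realType).

Lemma eventually_ln_ge (A : R) :
  exists N : nat, forall n, (N <= n)%N -> A <= ln (n%:R : R).
Proof.
exists (Num.bound (expR A)) => n Nn.
have An : expR A < n%:R.
  by apply: lt_le_trans (archi_boundP (expR_ge0 A)) _; rewrite ler_nat.
by rewrite -[A]expRK ler_ln ?posrE ?expR_gt0 ?ltW// (lt_trans (expR_gt0 A) An).
Qed.

(** With [c = L^0.8], the last bound reads [L^1.5 <= L^1.6]; for [L = ln n] it turns [exp (- c^2)]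
    into at most [n^(- sqrt L)]. *)
Lemma powR_eight_tenths (L : R) : 1 <= L ->
  [/\ L `^ (8 / 10) <= L, L <= (L `^ (8 / 10)) ^+ 2 &
      Num.sqrt L * L <= (L `^ (8 / 10)) ^+ 2].
Proof.
move=> L1; have L0 : 0 <= L by lra.
have L1E : L = L `^ 1 by rewrite powRr1.
rewrite -powR_mulrn ?powR_ge0// -powRrM; split.
- by rewrite [leRHS]L1E ler_powR//; lra.
- by rewrite [leLHS]L1E ler_powR//; lra.
- rewrite -powR12_sqrt// [X in _ * X]L1E -powRD; last by apply/implyP => _; lra.
  by rewrite ler_powR//; lra.
Qed.

(** * Both tails once [ln n] is large *)

Section large_size.
Context (n : nat) (p : R).
Let L : R := ln n%:R.
Let c : R := L `^ (8 / 10).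
Context (p01 : 0 <= p <= 1) (L_large : 192 ^+ 2 <= L).

Let L1 : 1 <= L. Proof. by move: L_large; rewrite expr2; lra. Qed.

Let cL : c <= L. Proof. by have [] := powR_eight_tenths L1. Qed.

Let Lc : L <= c ^+ 2. Proof. by have [] := powR_eight_tenths L1. Qed.

Let sLc : Num.sqrt L * L <= c ^+ 2. Proof. by have [] := powR_eight_tenths L1. Qed.

Let c_large : 192 <= c.
Proof.
rewrite -ler_sqr ?nnegrE ?powR_ge0//; exact: le_trans L_large Lc.
Qed.

Let n_gt0 : (0 < n)%N.
Proof.
by rewrite lt0n; apply/eqP => n0; move: L1; rewrite /L n0 ln0//; lra.
Qed.

Let n0R : 0 < n%:R :> R. Proof. by rewrite ltr0n. Qed.

Let nE : expR L = n%:R. Proof. by rewrite lnK// posrE. Qed.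

(** From [expR L >= L^4 / 24] and [L >= 192 = 24 * 8]. *)
Lemma cube_ln_le : 8 * L ^+ 3 <= n%:R.
Proof.
have L0 : 0 <= L by have := L1; lra.
rewrite -nE; apply: le_trans (expR_ge1Dxn 3 L0).
rewrite (_ : 4`!%:R = 24 :> R) // exprSr.
have := exprn_ge0 3 L0; have : 192 <= L by apply: le_trans c_large cL.
move: (L ^+ 3) => x; nra.
Qed.

(** The moment parameter is the same [c] as in the window. In the exponent
    [L + c (2 L - 3 c) + 1 - 2 c (L - l)] the terms [2 c L] cancel; the rest is at most [- c^2],
    since [l <= c / 4] and [L <= c^2]. *)
Lemma source_prob_le : p < 2 * L / n%:R - 3 * c / n%:R ->
  (Fmodel n p [set w | has_temporal_source (sample_tgraph w)] <=
   (2 * n%:R `^ (- Num.sqrt L))%:E)%E.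
Proof.
move=> ps; case/andP: p01 => p0 _; set l := ln (1 + 2 * c).
have c0 : 0 <= c by have := c_large; lra.
have L0 : 0 <= L by have := L1; lra.
have y_lt : n%:R * p < 2 * L - 3 * c.
  by rewrite mulrC -ltr_pdivlMr// mulrBl.
have p_le : p <= 2 * L / n%:R.
  by rewrite ler_pdivlMr// mulrC; move: y_lt; lra.
have L3n : 2 * L / n%:R * (4 * L ^+ 2) <= 1.
  have -> : 2 * L / n%:R * (4 * L ^+ 2) = 8 * L ^+ 3 / n%:R by ring.
  by rewrite ler_pdivrMr// mul1r cube_ln_le.
have L2 : 1 <= L ^+ 2 by rewrite expr_ge1// L1.
have p_half : p <= 2^-1.
  have h : 0 <= 2 * L / n%:R by rewrite divr_ge0// mulr_ge0.
  have := ler_wpM2l h L2; lra.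
have p1 : p < 1 by lra.
have l_le : l <= c / 4.
  rewrite -[leRHS]expRK ler_ln ?posrE ?expR_gt0//; last by lra.
  have c4 : 0 <= c / 4 by lra.
  apply: le_trans (expR_ge1Dxn 1 c4); rewrite (_ : 2`!%:R = 2 :> R) // expr2.
  by have := c_large; nra.
(* Replacing [p / (1 - p)] by [p] costs at most [2 c (n p) p <= 8 L^3 / n <= 1]. *)
have s_le : c * n%:R * (p / (1 - p)) <= c * (2 * L - 3 * c) + 1.
  have h1 : p / (1 - p) <= p * (1 + 2 * p).
    rewrite ler_wpM2l// -[leLHS]mul1r ler_pdivrMr ?subr_gt0//; nra.
  have h2 : 0 <= c * n%:R by rewrite mulr_ge0.
  apply: (le_trans (ler_wpM2l h2 h1)).
  have -> : c * n%:R * (p * (1 + 2 * p)) =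
      c * (n%:R * p) + 2 * c * (n%:R * p) * p by ring.
  apply: lerD; first by rewrite ler_wpM2l// ltW.
  apply: le_trans L3n.
  have h3 : 2 * c * (n%:R * p) <= 4 * L ^+ 2.
    have h4 : n%:R * p <= 2 * L by move: y_lt; lra.
    have h5 : 0 <= n%:R * p by rewrite mulr_ge0.
    have := ler_pM c0 h5 cL h4; rewrite expr2; lra.
  rewrite mulrC; apply: ler_pM => //; last by rewrite !mulr_ge0.
apply: (le_trans (@source_le R n p p01 c c0 p1)); rewrite lee_fin.
have pot := spread_potential_ge n_gt0 c0.
have pot0 : 0 < spread_potential n c n := lt_le_trans (expR_gt0 _) pot.
have -> : n%:R `^ (- Num.sqrt L) = expR (- (Num.sqrt L * L)).
  by rewrite /powR gt_eqF// mulNr.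
apply: (@le_trans _ _ (expR (- (Num.sqrt L * L)))); last first.
  by have := expR_ge0 (- (Num.sqrt L * L)); lra.
rewrite mulrA ler_pdivrMr// -nE -expRD.
apply: (@le_trans _ _ (expR (- (Num.sqrt L * L)) *
   expR (2 * c * (ln n%:R - ln (1 + 2 * c))))); last first.
  by rewrite ler_wpM2l// expR_ge0.
rewrite -expRD ler_expR nE -/L -/l.
have : 2 * c * l <= c ^+ 2 / 2.
  have := ler_wpM2l c0 l_le; rewrite expr2; lra.
have : 2 <= c ^+ 2 by rewrite expr2; have := c_large; nra.
move: s_le sLc Lc; rewrite expr2; lra.
Qed.

(** The part [L / 2] of [n p / 4] cancels the growth of the initial potential and leaves
    [expR (- z)], with [z] about [3 c / 4]; a cubic lower bound on [expR z] then beats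
    [L <= c^2]. *)
Lemma no_source_prob_le : p > 2 * L / n%:R + 3 * c / n%:R ->
  (Fmodel n p [set w | ~ has_temporal_source (sample_tgraph w)] <= (5 / L)%:E)%E.
Proof.
move=> ps.
have y_gt : 2 * L + 3 * c < n%:R * p.
  by rewrite [ltRHS]mulrC -ltr_pdivrMr// mulrDl.
have n_gt1 : (1 < n)%N.
  by rewrite -(ltr_nat R); apply: lt_le_trans cube_ln_le;
     have := exprn_ege1 3 L1; lra.
apply: (le_trans (@no_source_le R n p p01 n_gt0)); rewrite lee_fin.
apply: (le_trans (ler_wpM2l (expR_ge0 _) (escape_potential1_le R n_gt1))).
rewrite -/L -expRD; pose z := 3 * c / 4 - 3 / 2.
apply: (@le_trans _ _ (expR (- z))); first by rewrite ler_expR /z; lra.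
have L0 : 0 < L by apply: lt_le_trans L1.
rewrite expRN ler_pdivlMr// mulrC ler_pdivrMr ?expR_gt0//.
have z_ge : 3 * c / 8 <= z by rewrite /z; have := c_large; lra.
have z0 : 0 <= z by have := c_large; lra.
apply: (le_trans Lc).
apply: le_trans (_ : 5 * (1 + z ^+ 3 / 3`!%:R) <= _); last first.
  by rewrite ler_wpM2l// expR_ge1Dxn.
rewrite (_ : 3`!%:R = 6 :> R) //.
have z2 : (3 * c / 8) ^+ 2 <= z ^+ 2.
  by rewrite ler_sqr ?nnegrE//; have := c_large; lra.
(* Here [72 = 3 * 192 / 8] bounds [z] from below. *)
have z3 : 72 * z ^+ 2 <= z ^+ 3.
  by rewrite [leRHS]exprS ler_wpM2r ?sqr_ge0//; have := c_large; lra.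
have := sqr_ge0 c.
have -> : c ^+ 2 = (3 * c / 8) ^+ 2 * (64 / 9) by field.
move: z2 z3; lra.
Qed.

Let msource := @measurable_has_temporal_source R n.

Lemma Fprob_no_source_ge : p < 2 * L / n%:R - 3 * c / n%:R ->
  ((1 - 2 * n%:R `^ (- Num.sqrt L))%:E <=
   Fprob p (fun G : tgraph R 'I_n => ~ has_temporal_source G))%E.
Proof.
move=> /source_prob_le le; rewrite /Fprob.
rewrite (_ : [set w | _] = ~` [set w | has_temporal_source (sample_tgraph w)])//.
rewrite probability_setC; last exact: msource.
by rewrite EFinB leeB.
Qed.

Lemma Fprob_source_ge : p > 2 * L / n%:R + 3 * c / n%:R ->
  ((1 - 5 / L)%:E <= Fprob p (fun G : tgraph R 'I_n => has_temporal_source G))%E.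
Proof.
move=> /no_source_prob_le le; rewrite /Fprob.
rewrite (_ : [set w | _] = ~` [set w | ~ has_temporal_source (sample_tgraph w)]).
  rewrite probability_setC; last first.
    rewrite (_ : [set w | _] = ~` [set w | has_temporal_source (sample_tgraph w)])//.
    exact: measurableC.
  by rewrite EFinB leeB.
by apply/seteqP; split => w /= => [? []//|/contrapT].
Qed.

End large_size.

Lemma probability_cvg1 (u : nat -> \bar R) :
  (forall n, (0 <= u n <= 1)%E) ->
  (forall e : R, 0 < e -> exists N, forall n, (N <= n)%N -> ((1 - e)%:E <= u n)%E) ->
  u @ \oo --> 1%:E.
Proof.
move=> u01 H.
have ufin n : u n \is a fin_num.
  have /andP[u0 u1] := u01 n; rewrite ge0_fin_numE//.
  by apply: le_lt_trans u1 _; rewrite ltry.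
apply/fine_cvgP; split; first by near=> n; exact: ufin.
apply/cvgrPdist_le => e e0; have [N HN] := H e e0; near=> n.
have /andP[u0 u1] := u01 n.
have Nn : (N <= n)%N by near: n; exact: nbhs_infty_ge.
have := HN n Nn; move: u1 => /=; rewrite -(fineK (ufin n)) !lee_fin => h1 h2.
by rewrite ger0_norm ?subr_ge0//; lra.
Unshelve. all: by end_near. Qed.

End threshold.

Theorem theorem5p3 (R : realType) :
  sharp_threshold (fun n : nat => 2 * ln (n%:R : R) / n%:R)
    (fun n : nat => @has_temporal_source R 'I_n) /\
  let eps := fun n : nat => 3 * (ln (n%:R : R) `^ (8 / 10)) / n%:R in
  exists N : nat, forall n : nat, (N <= n)%N ->
    forall p : R, 0 <= p <= 1 ->
      (p < 2 * ln n%:R / n%:R - eps n ->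
        ((1 - 2 * n%:R `^ (- Num.sqrt (ln n%:R)))%:E <=
          Fprob p (fun G : tgraph R 'I_n => ~ has_temporal_source G))%E) /\
      (p > 2 * ln n%:R / n%:R + eps n ->
        ((1 - 5 / ln n%:R)%:E <=
          Fprob p (fun G : tgraph R 'I_n => has_temporal_source G))%E).
Proof.
split; last first.
  have [N HN] := eventually_ln_ge (192 ^+ 2 : R).
  exists N => n /HN Ln p p01.
  by split => [/(Fprob_no_source_ge p01 Ln)|/(Fprob_source_ge p01 Ln)].
move=> e e0.
have mQ n := @measurable_has_temporal_source R n.
have clip (x : R) : 0 <= clip01 x <= 1.
  by rewrite /clip01 le_max lexx /= ge_max ler01 /= ge_min lexx.
(* Since [2 e B = 4 e + 3 > 3], the bound [B c <= L] puts the window [3 c / n] below [e] times the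
   threshold. The power [B^5] in [A] comes from [L / c = L^0.2]. *)
pose B := 2 + 3 / (2 * e).
have B2 : 2 <= B by rewrite lerDl divr_ge0// mulr_ge0// ltW.
pose A := Num.max (192 ^+ 2) (B ^+ 5).
have large n : A <= ln (n%:R : R) ->
  [/\ 192 ^+ 2 <= ln (n%:R : R), 1 <= ln (n%:R : R), (0 < n%:R :> R) &
     0 < ln (n%:R : R) `^ (8 / 10) /\ B * (ln (n%:R : R) `^ (8 / 10)) <= ln n%:R].
  rewrite ge_max => /andP[L1 LB].
  have L1' : 1 <= ln (n%:R : R) by move: L1; rewrite expr2; lra.
  split => //.
    by rewrite ltr0n lt0n; apply/eqP => n0; move: L1'; rewrite n0 ln0//; lra.
  have L0 : 0 <= ln (n%:R : R) by lra.
  split; first by apply: powR_gt0; lra.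
  apply: (@le_trans _ _ (ln (n%:R : R) `^ (2 / 10) * ln n%:R `^ (8 / 10))).
    rewrite ler_wpM2r ?powR_ge0//.
    have -> : B = (B ^+ 5) `^ (2 / 10).
      rewrite -powR_mulrn -?powRrM; last by lra.
      by rewrite (_ : 5%:R * (2 / 10) = 1 :> R) ?powRr1//; lra.
    by apply: ge0_ler_powR => //; rewrite ?nnegrE ?exprn_ge0//; lra.
  rewrite -powRD; last by apply/implyP => _; lra.
  by rewrite (_ : 2 / 10 + 8 / 10 = 1 :> R) ?powRr1//; lra.
have eB : 3 < 2 * e * B.
  by rewrite /B mulrDr (mulrC _ (3 / _)) divfK ?gt_eqF ?mulr_gt0//; lra.
split.
- apply: probability_cvg1 => [n|d d0].
    rewrite measure_ge0 probability_le1//.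
    rewrite (_ : [set w | _] = ~` [set w | has_temporal_source (sample_tgraph w)])//.
    by apply: measurableC; exact: mQ.
  have [N HN] := eventually_ln_ge (Num.max A (2 / d)).
  exists N => n /HN; rewrite ge_max => /andP[/large[L192 L1 n0 [c0 LB]] Ld].
  move: (L192) L1 c0 LB Ld; set L := ln _; set c := L `^ _ => {}L192 L1 c0 LB Ld.
  apply: le_trans (Fprob_no_source_ge (clip _) L192 _).
    rewrite lee_fin lerB// (@le_trans _ _ (2 * L^-1))//.
      rewrite ler_wpM2l// /powR gt_eqF// mulNr expRN lef_pV2 ?posrE ?expR_gt0//.
        apply: (@le_trans _ _ (expR L)).
          by apply: le_trans (expR_ge1Dx L); lra.
        rewrite ler_expR; apply: ler_peMl; first exact: le_trans L1.
        by have := ler_wsqrtr L1; rewrite sqrtr1.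
      by apply: lt_le_trans L1.
    rewrite ler_pdivrMr; last by apply: lt_le_trans L1.
    by move: Ld; rewrite ler_pdivrMr// mulrC.
  (* The value 0 produced by clipping also lies below the window, as [3 c < 2 L]. *)
  rewrite -/L -/c -mulrBl /clip01 gt_max gt_min; apply/andP; split.
    rewrite divr_gt0// subr_gt0; have := ler_wpM2r (ltW c0) B2; lra.
  apply/orP; right; rewrite mulrA ltr_pM2r ?invr_gt0//.
  have eL := ler_wpM2l (ltW e0) LB; have ec := ltr_pM2r c0 3 (2 * e * B).
  by move: eL; rewrite -ec in eB; lra.
- apply: probability_cvg1 => [n|d d0].
    by rewrite measure_ge0 probability_le1//; exact: mQ.
  have [N HN] := eventually_ln_ge (Num.max A (5 / d)).
  exists N => n /HN; rewrite ge_max => /andP[/large[L192 L1 n0 [c0 LB]] Ld].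
  have L3 := cube_ln_le L192.
  move: (L192) L1 c0 LB Ld L3; set L := ln _; set c := L `^ _ => {}L192 L1 c0 LB Ld L3.
  apply: le_trans (Fprob_source_ge (clip _) L192 _).
    rewrite lee_fin lerB// ler_pdivrMr; last by apply: lt_le_trans L1.
    by move: Ld; rewrite ler_pdivrMr// mulrC.
  (* The value 1 produced by clipping also lies above the window, as [2 L + 3 c < 8 L^3 <= n]. *)
  rewrite -/L -/c -mulrDl /clip01 lt_max lt_min; apply/orP; right; apply/andP; split.
    rewrite ltr_pdivrMr// mul1r; apply: lt_le_trans L3.
    have := ler_wpM2r (ltW c0) B2.
    have : L <= L ^+ 3 by rewrite ler_eXnr.
    lra.
  rewrite mulrA ltr_pM2r ?invr_gt0//.
  have eL := ler_wpM2l (ltW e0) LB; have ec := ltr_pM2r c0 3 (2 * e * B).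
  by move: eL; rewrite -ec in eB; lra.
Qed.
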